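(* Let $d\ge 3$ and let $V$ be a potential with distribution function $F$. (i) If $F\in\mathcal{D}_1$, there are a set $\bar\Omega$ of full $\mathbb{P}$-probability and a constant $\kappa=\kappa(d,F)\in(0,\infty)$ such that for all $\omega\in\bar\Omega$, $$\limsup_{|y|\to\infty,\ y\in\mathbb{Z}^d}\frac{\hat{E}_{0,\omega}^{y}(H(y))}{|y|}<\kappa.$$ (ii) If $F\in\mathcal{D}$, there exists a constant $D(d)$, depending only on $d$, such that for all $y\in\mathbb{Z}^d$ with $y\ne 0$, $$\frac{\hat{\mathbb{E}}_{0}^{y}(H(y))}{|y|}\le D(d)\,\frac{1}{-\ln\int e^{-t}\,dF(t)}\Big(\ln 2d-\ln\int e^{-t}\,dF(t)\Big).$$
   Context: $(S_n)_{n\ge 0}$ is the simple (symmetric, nearest-neighbour) random walk on $\mathbb{Z}^d$; $P_x,E_x$ denote its law and expectation when started at $x$. Independently of the walk, the potential $V(x,\omega)$, $x\in\mathbb{Z}^d$, is a family of i.i.d. non-negative random variables with distribution function $F$, defined on a probability space $(\Omega,\mathcal{F},\mathbb{P})$ with expectation $\mathbb{E}$. For $y\in\mathbb{Z}^d$, $|y|$ is the $\ell_1$-norm. $\mathcal{D}$ is the set of distribution functions $F$ which assign zero measure to $(-\infty,0)$ and satisfy $F(0)<1$; $\mathcal{D}_1$ is the subset of those $F\in\mathcal{D}$ with finite mean. For $y\in\mathbb{Z}^d$, $H(y)=\inf\{n\ge 0:S_n=y\}$ (with $\inf\emptyset=+\infty$). For $x,y\in\mathbb{Z}^d$, $e(x,y,\omega)=E_x\big[\exp(-\sum_{m=0}^{H(y)-1}V(S_m,\omega))\mathbf{1}_{\{H(y)<\infty\}}\big]$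 (equal to $1$ if $x=y$). Quenched path measure: the walk is killed at each step from $x$ with probability $1-e^{-V(x,\omega)}$ and otherwise moves as the simple random walk; $\hat{P}_{x,\omega}^{y}$ is the law of this walk started at $x$ conditioned to reach $y$ before being killed. Thus, for a non-negative functional $X$ of the path up to time $H(y)$, $$\hat{E}_{x,\omega}^{y}(X)=\frac{E_x\big[X\exp(-\sum_{m=0}^{H(y)-1}V(S_m,\omega))\mathbf{1}_{\{H(y)<\infty\}}\big]}{e(x,y,\omega)}.$$ Annealed path measure: $\hat{\mathbb{P}}_x^y$ is obtained by first averaging the law of the killed walk over $\mathbb{P}$ and then conditioning on reaching $y$; thus $$\hat{\mathbb{E}}_{x}^{y}(X)=\frac{\mathbb{E}E_x\big[X\exp(-\sum_{m=0}^{H(y)-1}V(S_m,\omega))\mathbf{1}_{\{H(y)<\infty\}}\big]}{\mathbb{E}[e(x,y,\omega)]}.$$ *)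

(* Defs.v *)
From HB Require Import structures.
From mathcomp Require Import all_boot all_order all_algebra.
From mathcomp Require Import all_classical all_reals all_analysis.

Set Implicit Arguments.
Unset Strict Implicit.
Unset Printing Implicit Defensive.

Import Order.TTheory GRing.Theory Num.Theory.
Import numFieldNormedType.Exports.

Local Open Scope classical_set_scope.
Local Open Scope ring_scope.

Definition l1norm (d : nat) (y : 'rV[int]_d) : nat :=
  (\sum_(i < d) `|y ord0 i|)%N.

(* limsup of f(y) as |y| -> oo, y in Z^d (the unfolding of limf_esup for the
   filter generated by the sets {y : |y| >= N}; limf_esup itself cannot be used
   since 'rV[int]_d is not a filteredType). *)
Definition limsup_infty (R : realType) (d : nat) (f : 'rV[int]_d -> \bar R) :
    \bar R :=
  ereal_inf [set ereal_sup (f @` A) | A in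
    filter_from setT (fun N : nat => [set y : 'rV[int]_d | (N <= l1norm y)%N])].

Definition srw_step (R : realType) (d : nat) (x y : 'rV[int]_d) : R :=
  if l1norm (y - x) == 1%N then ((2 * d)%N%:R)^-1 else 0.

(* S, defined on (W, PW), is a simple random walk started at x: the Markov
   chain on Z^d with kernel srw_step, given by its finite-dimensional laws.
   Any realization of the walk is allowed; integrals against PW of functionals
   of S are the expectations E_x. *)
Record simple_random_walk (R : realType) (d : nat) (dW : measure_display)
    (W : measurableType dW) (PW : probability W R)
    (S : nat -> W -> 'rV[int]_d) (x : 'rV[int]_d) : Prop := {
  srw_measurable : forall n z, measurable [set w | S n w = z];
  srw_law : forall (n : nat) (z : nat -> 'rV[int]_d),
    PW [set w | forall k, (k <= n)%N -> S k w = z k]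
    = ((z 0%N == x)%:R * \prod_(k < n) srw_step R (z k) (z k.+1))%:E }.

(* A distribution function is a right-continuous nondecreasing function with
   limits 0 at -oo and 1 at +oo; dF is its Lebesgue-Stieltjes measure. *)
Definition class_D (R : realType) (F : cumulativeBounded (0 : R) (1 : R)) :
    Prop :=
  lebesgue_stieltjes_measure F `]-oo, 0[ = 0%E /\ F 0 < 1.

Definition class_D1 (R : realType) (F : cumulativeBounded (0 : R) (1 : R)) :
    Prop :=
  class_D F /\
  (lebesgue_stieltjes_measure F).-integrable setT (fun t : R => t%:E).

Definition laplace1 (R : realType) (F : cumulativeBounded (0 : R) (1 : R)) :
    R :=
  \int[lebesgue_stieltjes_measure F]_t expR (- t).

Definition mutually_independent (R : realType) (I : choiceType)
    (dO : measure_display) (Omega : measurableType dO)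
    (P : probability Omega R) (V : I -> {RV P >-> R}) : Prop :=
  forall (s : seq I) (B : I -> set R), uniq s ->
    (forall z, measurable (B z)) ->
    P [set omega | forall z, z \in s -> B z (V z omega)]
    = (\prod_(z <- s) P (V z @^-1` B z))%E.

Record iid_potential (R : realType) (d : nat)
    (F : cumulativeBounded (0 : R) (1 : R))
    (dO : measure_display) (Omega : measurableType dO)
    (P : probability Omega R) (V : 'rV[int]_d -> {RV P >-> R}) : Prop := {
  potential_ge0 : forall z omega, 0 <= V z omega;
  potential_cdf : forall z r, cdf (V z) r = (F r)%:E;
  potential_indep : mutually_independent V }.

Section crossing.
Context (R : realType) (d : nat) (dW : measure_display)
  (W : measurableType dW) (PW : probability W R) (S : nat -> W -> 'rV[int]_d).
Local Open Scope ereal_scope.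

Definition hitting_time (y : 'rV[int]_d) (w : W) : option nat :=
  match pselect (exists n, S n w == y) with
  | left ex => Some (ex_minn ex)
  | right _ => None
  end.

Definition extended_hitting_time (y : 'rV[int]_d) (w : W) : \bar R :=
  if hitting_time y w is Some n then n%:R%:E else +oo.

Definition survival_weight (v : 'rV[int]_d -> R) (y : 'rV[int]_d) (w : W) : R :=
  if hitting_time y w is Some n then expR (- \sum_(m < n) v (S m w))%R else 0%R.

(* E_x[X exp(- sum_(m < H(y)) v(S_m)) ; H(y) < oo], H the hitting time; the starting point x is
   that of S. *)
Definition killed_expectation (v : 'rV[int]_d -> R) (y : 'rV[int]_d)
    (X : W -> \bar R) : \bar R :=
  \int[PW]_w (X w * (survival_weight v y w)%:E).

Definition crossing_weight (v : 'rV[int]_d -> R) (y : 'rV[int]_d) : \bar R :=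
  killed_expectation v y (cst 1).

Definition quenched_expectation (v : 'rV[int]_d -> R) (y : 'rV[int]_d)
    (X : W -> \bar R) : \bar R :=
  killed_expectation v y X / crossing_weight v y.

Definition annealed_expectation (dO : measure_display)
    (Omega : measurableType dO) (P : probability Omega R)
    (V : 'rV[int]_d -> Omega -> R) (y : 'rV[int]_d) (X : W -> \bar R) : \bar R :=
  (\int[P]_omega killed_expectation (V ^~ omega) y X) /
  (\int[P]_omega crossing_weight (V ^~ omega) y).

End crossing.

(* Main.v *)
Require Import Defs.
From HB Require Import structures.
From mathcomp Require Import all_boot all_order all_algebra.
From mathcomp Require Import ring lra zify.
From mathcomp Require Import all_classical all_reals all_analysis.
From mathcomp Require Import measurable_realfun.

Set Implicit Arguments.
Unset Strict Implicit.
Unset Printing Implicit Defensive.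

Import Order.TTheory GRing.Theory Num.Theory.
Import numFieldNormedType.Exports.

Local Open Scope classical_set_scope.
Local Open Scope ring_scope.

(** Expectations of functionals of the path up to the hitting time are sums of
    path weights over the paths from [0] to their first visit of [y], each weight
    being the probability of the path times the exponential of minus the
    potential along it ([walk_expectationE]).  The expected hitting time is then
    the ratio of the sum of length times weight to the sum of the weights.

    Length is compared with the number of visited sites.  A path with a marked
    time is determined by the path obtained by excising the loop between the
    marked time and the first visit of the site occupied then, by that site, and
    by the loop.  In dimension at least 3 the loops at a site have bounded total
    probability, so the sum of the lengths is at most a constant times the sum of
    the numbers of visited sites ([loop_excision]).  The bound on the Green
    function ([green_bounded]) comes from an explicit superharmonic function, the
    power -1/4 of [1000 + |x|^2], with the Euclidean norm.

    In the annealed case every visited site costs at least the factor [phi],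
    the integral of [expR (- t)] under [F], while one shortest path shows that the
    averaged crossing weight is at least [(phi / 2 d) ^ |y|].  Paths visiting more
    than [|y| (ln (2 d) - ln phi) / (- ln phi)] sites therefore contribute no more
    than a constant times what the bound allows ([annealed_hitting_le]).

    In the quenched case the same comparison has to hold for almost every
    environment and all far [y] at once.  For the upper bound, half of the cost
    per visited site is refunded: the resulting sum over all paths from [0],
    damped at the end point, has finite expectation, hence is finite almost surely
    ([ae_outward_mass_fin]).  For the lower bound, the potential has only a finite
    mean, and the sites next to [y] may be very expensive.  But among about
    [ln |y|] disjoint translates of a monotone route to the neighbourhood of [y],
    and among about [ln |y|] concentric spheres around [y], at least one costs no
    more than [K |y|]: for [K] large enough, the probability that all of them are
    more expensive is bounded by a power of [1 / |y|] with exponent greater than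
    [d], so almost surely this fails for finitely many [y] only ([ae_good_scale]).
    This gives a path of weight at least [expR (- c |y|)] from [0] to any point of
    the chosen sphere ([reach_sphere]).

    A crossing path is finally cut at its last point on this sphere
    ([range_crossing_le]).  The sites visited afterwards lie in a cube of
    logarithmic size.  If the first part is long, it is exchanged for the cheap
    path to the same point; the weight of the second part is thereby bounded by
    the crossing weight times [expR (c |y|)], and this factor is beaten by the
    exponential smallness of the mass of long first parts.  The potential next to
    [y] enters both terms of the ratio and cancels. *)

(** * Sums over countable index sets *)

Lemma esum_subset (R : realType) (T : choiceType) (P Q : set T)
    (a : T -> \bar R) :
  P `<=` Q -> (\esum_(i in P) a i <= \esum_(i in Q) a i)%E.
Proof.
move=> PQ; apply: ge_ereal_sup => _ [A [finA AP] <-].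
by apply: ereal_sup_ubound; exists A => //; split=> // i /AP /PQ.
Qed.

Lemma esum_inj_le (R : realType) (T T' : choiceType) (P : set T) (Q : set T')
    (e : T -> T') (a : T' -> \bar R) :
  set_inj P e -> (forall i, P i -> Q (e i)) ->
  (\esum_(i in P) a (e i) <= \esum_(j in Q) a j)%E.
Proof.
move=> inj PQ; rewrite -esum_image//; apply: esum_subset.
by move=> _ [i Pi <-]; exact: PQ.
Qed.

Lemma esumZl (R : realType) (T : choiceType) (P : set T) (c : R)
    (a : T -> \bar R) : 0 <= c -> (forall i, (0 <= a i)%E) ->
  (\esum_(i in P) (c%:E * a i) = c%:E * \esum_(i in P) a i)%E.
Proof.
move=> c0 a0; rewrite /esum -ereal_supZl//; last first.
  apply/set0P; exists (\sum_(i \in set0) a i)%E; exists set0 => //.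
  exact: fsets_set0.
by rewrite image_comp; congr ereal_sup; apply: eq_imagel => A _ /=;
  rewrite ge0_mule_fsumr.
Qed.

(** Integrals commute with series indexed by [nat]; a countable index set is
    brought to that form by its encoding, with [0] at unused codes. *)
Lemma esum_pickle (R : realType) (T : countType) (a : T -> \bar R) :
  (forall i, (0 <= a i)%E) ->
  (\esum_(i in [set: T]) a i =
   \sum_(n <oo) if @pickle_inv T n is Some i then a i else 0)%E.
Proof.
move=> a0; rewrite nneseries_esumT; last by move=> n; case: pickle_inv.
rewrite [RHS](esumID (range (@pickle T)))/=; last first.
  by move=> n _; case: pickle_inv.
rewrite !setTI [X in (_ + X)%E]esum1 ?adde0.
  rewrite esum_image; last by move=> i j _ _; exact: (pcan_inj pickleK).
  by apply: eq_esum => i _; rewrite pickleK_inv.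
move=> n /= nT; case: (@pickle_inv T n) (@pickle_invK T n) => //= i in_.
by exfalso; apply: nT; exists i.
Qed.

Section integral_esum.
Context {d : measure_display} {X : measurableType d} {R : realType}
  (T : countType) (mu : {measure set X -> \bar R}) (f : T -> X -> \bar R).
Hypothesis mf : forall i, measurable_fun [set: X] (f i).
Hypothesis f0 : forall i x, (0 <= f i x)%E.

Let esum_pickleT (P : set T) x : (\esum_(i in P) f i x =
  \sum_(n <oo) if @pickle_inv T n is Some i then
    (if i \in P then f i x else 0) else 0)%E.
Proof. by rewrite esum_mkcond esum_pickle// => i; case: ifP. Qed.

Let mg (P : set T) n : measurable_fun [set: X] (fun x =>
  if @pickle_inv T n is Some i then (if i \in P then f i x else 0) else 0)%E.
Proof. by case: pickle_inv => // i; case: (i \in P). Qed.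

Let g0 (P : set T) n x : (0 <=
  if @pickle_inv T n is Some i then (if i \in P then f i x else 0) else 0)%E.
Proof. by case: pickle_inv => // i; case: ifP. Qed.

Lemma measurable_fun_esum (P : set T) :
  measurable_fun [set: X] (fun x => \esum_(i in P) f i x)%E.
Proof.
under eq_fun do rewrite esum_pickleT.
have := @ge0_emeasurable_sum _ X R [set: X] _ xpredT (fun k x _ _ => g0 P k x)
  (fun k _ => mg P k).
by apply: eq_measurable_fun => x _.
Qed.

Lemma integral_esum (P : set T) :
  (\int[mu]_x (\esum_(i in P) f i x) = \esum_(i in P) \int[mu]_x f i x)%E.
Proof.
under eq_integral do rewrite esum_pickleT.
rewrite integral_nneseries; [|by []|exact: mg|by move=> n x _; exact: g0].
rewrite [RHS]esum_mkcond esum_pickle; last first.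
  by move=> i; case: ifP => // _; exact: integral_ge0.
apply: eq_eseriesr => n _; case: pickle_inv => [i|]; last by rewrite integral0.
by case: ifP => // _; rewrite integral0.
Qed.

End integral_esum.

Lemma esum_pair (R : realType) (T1 T2 : choiceType) (P : set T1)
    (Q : T1 -> set T2) (a : T1 -> T2 -> \bar R) :
  (forall i j, (0 <= a i j)%E) ->
  (\esum_(k in [set k | P k.1 /\ Q k.1 k.2]) a k.1 k.2 =
   \esum_(i in P) \esum_(j in Q i) a i j)%E.
Proof. by move=> a0; rewrite esum_esum. Qed.

(** Gives access to sums over infinite sets of paths by induction on a bound of
    their length. *)
Lemma esum_le_exhaustion (R : realType) (T : choiceType) (P : set T)
    (a : T -> \bar R) (sz : T -> nat) (M : \bar R) :
  (forall N, (\esum_(i in [set i | P i /\ (sz i < N)%N]) a i <= M)%E) ->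
  (\esum_(i in P) a i <= M)%E.
Proof.
move=> PM; apply: ge_ereal_sup => _ [A [finA AP] <-].
have [N AN] : exists N, forall i, A i -> (sz i < N)%N.
  have /finite_seqP[s ->] := finA.
  exists (\max_(i <- s) sz i).+1 => i /= si; rewrite ltnS.
  exact: leq_bigmax_seq.
apply: le_trans (PM N); apply: ereal_sup_ubound; exists A => //; split=> // i Ai.
by split; [exact: AP|exact: AN].
Qed.

Lemma esum_le_seq (R : realType) (T : choiceType) (s : seq T) (P : set T)
    (a : T -> \bar R) :
  (forall i, (0 <= a i)%E) -> (forall i, P i -> a i != 0%E -> i \in s) ->
  (\esum_(i in P) a i <= \sum_(i <- s) a i)%E.
Proof.
move=> a0 supp; apply: (@le_trans _ _ (\esum_(i in [set` undup s]) a i)%E).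
  rewrite (esumID [set i | a i = 0%E])//= esum1 ?add0e; last by move=> i [].
  apply: esum_subset => i [Pi /= /eqP ai]; rewrite mem_undup; exact: supp.
rewrite esum_fset; [|by apply/finite_seqP; exists (undup s)|by []].
rewrite -fsbig_seq ?undup_uniq//.
elim: s {supp} => [|x s IH] /=; first by rewrite big_nil.
rewrite big_cons; case: ifP => _; last by rewrite big_cons; apply: leeD.
by apply: le_trans IH _; rewrite leeDr.
Qed.

(** * Paths of the walk and superharmonic functions *)

Section walk_paths.
Context {R : realType} {d : nat}.
Local Notation T := 'rV[int]_d.
Implicit Types (x y z : T) (p : seq T) (v : T -> R).

Fixpoint step_prob x p : R :=
  if p is a :: p' then srw_step R x a * step_prob a p' else 1.

(** A path is given by its starting point [x] and the list [p] of its later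
    points.  As in the definition of the crossing weights, the potential at the
    end point is not charged, which makes weights multiplicative under
    concatenation. *)
Definition path_weight v x p : R :=
  step_prob x p * expR (- \sum_(z <- belast x p) v z).

Definition unit_step (i : 'I_d) (b : bool) : T :=
  if b then delta_mx ord0 i else - delta_mx ord0 i.

Lemma srw_step_ge0 x y : 0 <= srw_step R x y.
Proof. by rewrite /srw_step; case: ifP. Qed.

Lemma step_prob_ge0 x p : 0 <= step_prob x p.
Proof. by elim: p x => //= a p IH x; rewrite mulr_ge0 ?srw_step_ge0. Qed.

Lemma step_prob_cat x p q :
  step_prob x (p ++ q) = step_prob x p * step_prob (last x p) q.
Proof. by elim: p x => /= [x|a p IH x]; rewrite ?mul1r// IH mulrA. Qed.

Lemma path_weight_ge0 v x p : 0 <= path_weight v x p.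
Proof. by rewrite mulr_ge0 ?step_prob_ge0 ?expR_ge0. Qed.

Lemma path_weight_cat v x p q :
  path_weight v x (p ++ q) = path_weight v x p * path_weight v (last x p) q.
Proof.
by rewrite /path_weight step_prob_cat belast_cat big_cat opprD expRD mulrACA.
Qed.

Lemma path_weight_le v x p : (forall z, 0 <= v z) ->
  path_weight v x p <= step_prob x p.
Proof.
move=> v0; rewrite /path_weight ler_piMr ?step_prob_ge0//.
by rewrite -expR0 ler_expR oppr_le0 sumr_ge0.
Qed.

Lemma l1norm_eq1 z : l1norm z = 1%N -> exists i b, z = unit_step i b.
Proof.
move=> /eqP/sum_nat_eq1[i [_ zi zj]].
exists i, (z ord0 i == 1); apply/rowP => j; rewrite (_ : 0 = ord0); last first.
  exact: val_inj.
rewrite /unit_step.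
have [->|ji] := eqVneq j i.
  by case: eqP zi => ziE zi; rewrite !mxE !eqxx/=; lia.
by have := zj j ji isT; case: ifP => _; rewrite !mxE (negPf ji) !andbF/=; lia.
Qed.

Lemma esum_srw_step_le (h : T -> R) x : (forall y, 0 <= h y) ->
  (\esum_(a in [set: T]) (srw_step R x a * h a)%:E <=
   ((2 * d)%N%:R^-1 * \sum_(i < d) \sum_(b : bool) h (x + unit_step i b))%:E)%E.
Proof.
move=> h0; pose s := [seq x + unit_step u.1 u.2 | u <- enum {: 'I_d * bool}].
apply: le_trans (@esum_le_seq _ _ s _ _ _ _) _.
- by move=> a; rewrite lee_fin mulr_ge0 ?srw_step_ge0.
- move=> a _; rewrite eqe mulf_eq0 negb_or /srw_step => /andP[+ _].
  case: ifP => [/eqP/l1norm_eq1[i [b abx]] _|]; last by rewrite eqxx.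
  by apply/mapP; exists (i, b); rewrite ?mem_enum//= -abx addrC subrK.
rewrite big_map big_enum/= -(pair_bigA _ (fun i b =>
  (srw_step R x (x + unit_step i b) * h (x + unit_step i b))%:E))/=.
under eq_bigr do rewrite sumEFin.
rewrite sumEFin lee_fin mulr_sumr; apply: ler_sum => i _.
rewrite mulr_sumr; apply: ler_sum => b _.
rewrite ler_wpM2r// /srw_step; case: ifP => // _.
Qed.

(** The expectation of [h] along the walk drops by at least the expectation of
    [w] at every step and stays nonnegative, so the total of the drops is at most
    the initial value [h x].  Truncating at paths of length less than [N] turns
    this into an induction on [N]. *)
Lemma esum_superharmonic (h w : T -> R) x :
  (forall y, 0 <= h y) -> (forall y, 0 <= w y) ->
  (forall y, (2 * d)%N%:R^-1 * \sum_(i < d) \sum_(b : bool) h (y + unit_step i b)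
     + w y <= h y) ->
  (\esum_(p in [set: seq T]) (step_prob x p * w (last x p))%:E <= (h x)%:E)%E.
Proof.
move=> h0 w0 hw; apply: (esum_le_exhaustion (sz := size)) => N.
have F0 z p : (0 <= (step_prob z p * w (last z p))%:E)%E.
  by rewrite lee_fin mulr_ge0 ?step_prob_ge0.
elim: N x => [|N IH] x; first by rewrite esum1 ?lee_fin// => p [].
rewrite (esumID [set [::]])//.
apply: le_trans (leeD (b := (w x)%:E)
  (y := ((2 * d)%N%:R^-1 * \sum_(i < d) \sum_(b : bool) h (x + unit_step i b))%:E) _ _) _.
- apply: le_trans (@esum_subset _ _ _ [set [::]] _ _) _; first by move=> p [].
  by rewrite esum_set1 ?mul1r ?lee_fin//= mul1r.
- apply: (@le_trans _ _ (\esum_(k in [set k : T * seq T | True /\ (size k.2 < N)%N])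
    (step_prob x (k.1 :: k.2) * w (last x (k.1 :: k.2)))%:E)%E).
    rewrite -(@esum_image _ _ _ _ (fun k : T * seq T => k.1 :: k.2)
      (fun p => (step_prob x p * w (last x p))%:E)); last first.
      by move=> [a p] [b q] _ _ /= [-> ->].
    apply: esum_subset => -[|a p] [[_ /= sz] nnil]; first by case: nnil.
    by exists (a, p).
  rewrite (@esum_pair _ _ _ setT (fun _ => [set p | (size p < N)%N])
    (fun a p => (step_prob x (a :: p) * w (last x (a :: p)))%:E)) //.
  apply: le_trans (esum_srw_step_le x h0); apply: le_esum => a _ /=.
  under eq_esum do rewrite -mulrA EFinM.
  rewrite esumZl ?srw_step_ge0// EFinM lee_wpmul2l ?lee_fin ?srw_step_ge0//.
  apply: le_trans (IH a); apply: esum_subset => p //.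
- by rewrite -EFinD lee_fin addrC.
Qed.

End walk_paths.

(** * Transience in dimension at least three *)

Section transience.
Context {R : realType} {d : nat}.
Local Notation T := 'rV[int]_d.

(** The constant keeps the relative change of [radius2] in one step below [1/16],
    the range in which the expansion of the power [-1/4] is controlled. *)
Definition radius2 (x : T) : R := 1000 + \sum_(i < d) ((x ord0 i)%:~R) ^+ 2.

Definition superh (x : T) : R := Num.sqrt (Num.sqrt (radius2 x)^-1).

Definition defect (x : T) : R := (48 * radius2 x ^+ 2)^-1.

Lemma radius2_ge (x : T) i : 1000 + ((x ord0 i)%:~R) ^+ 2 <= radius2 x.
Proof.
rewrite /radius2 lerD2l (bigD1 i)//= lerDl sumr_ge0// => j _; exact: sqr_ge0.
Qed.

Lemma radius2_ge1000 x : 1000 <= radius2 x.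
Proof. by rewrite /radius2 lerDl sumr_ge0// => j _; exact: sqr_ge0. Qed.

Lemma radius2_gt0 x : 0 < radius2 x.
Proof. by have := radius2_ge1000 x; lra. Qed.

Lemma radius2_unit_step x i b :
  radius2 (x + unit_step i b) =
  radius2 x + (1 + (if b then 1 else -1) * (2 * (x ord0 i)%:~R)).
Proof.
rewrite /radius2 (bigD1 i)//= [in RHS](bigD1 i)//=.
have -> : \sum_(j < d | j != i) ((x + unit_step i b) ord0 j)%:~R ^+ 2 =
    \sum_(j < d | j != i) (x ord0 j)%:~R ^+ 2 :> R.
  apply: eq_bigr => j ji; rewrite /unit_step.
  by case: b; rewrite !mxE (negPf ji) andbF ?oppr0 addr0.
have -> : ((x + unit_step i b) ord0 i)%:~R =
    (x ord0 i)%:~R + (if b then 1 else -1) :> R.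
  by rewrite /unit_step; case: b; rewrite !mxE !eqxx/= rmorphD ?rmorphN.
by case: b; ring.
Qed.

Lemma superh_gt0 x : 0 < superh x.
Proof. by rewrite !sqrtr_gt0 invr_gt0 radius2_gt0. Qed.

Lemma radius2_ge0 x : 0 <= radius2 x.
Proof. exact/ltW/radius2_gt0. Qed.

Lemma superh_ge0 x : 0 <= superh x.
Proof. exact: sqrtr_ge0. Qed.

Lemma superh4 x : superh x ^+ 4 = (radius2 x)^-1.
Proof.
rewrite (exprM _ 2 2) sqr_sqrtr ?sqrtr_ge0// sqr_sqrtr// invr_ge0.
exact/ltW/radius2_gt0.
Qed.

Lemma superh_le1 x : superh x <= 1.
Proof.
rewrite -(@ler_pXn2r _ 4) ?nnegrE ?superh_ge0// superh4 expr1n.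
by rewrite invf_le1 ?radius2_gt0//; have := radius2_ge1000 x; lra.
Qed.

Lemma superh_ge x : (radius2 x)^-1 <= superh x.
Proof.
have s1 := radius2_ge1000 x; have s0 := radius2_gt0 x.
rewrite -(@ler_pXn2r _ 4) ?nnegrE ?superh_ge0 ?invr_ge0 ?radius2_ge0// superh4.
rewrite -[leRHS]expr1 ler_wiXn2l ?invr_ge0 ?radius2_ge0// invf_le1//; lra.
Qed.

(** The right-hand factor is a quadratic upper bound for [(1 + v) ^ (-1/4)].
    Its coefficient [11/64] lies strictly between the Taylor coefficient [10/64],
    which makes the bound hold near [0], and [12/64], below which the second-order
    term is beaten by the first-order one in dimension 3. *)
Lemma quarter_power_bound (v : R) : - (1 / 16) <= v -> v <= 1 / 16 ->
  1 <= (1 - v / 4 + 11 / 64 * v ^+ 2) ^+ 4 * (1 + v).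
Proof.
move=> v1 v2.
have v0 : 0 <= v ^+ 2 by exact: sqr_ge0.
set q := 1 - v / 4 + 11 / 64 * v ^+ 2; pose p := 1 - v / 2 + 2 / 5 * v ^+ 2.
have p0 : 0 <= p by rewrite /p; nra.
have qp : p <= q ^+ 2.
  rewrite -subr_ge0 (_ : _ - _ =
    v ^+ 2 * (1 / 160 - 11 / 128 * v + (11 / 64) ^+ 2 * v ^+ 2)).
    by apply: mulr_ge0 => //; nra.
  by rewrite /p /q; field.
have pp : 1 <= p ^+ 2 * (1 + v).
  rewrite -subr_ge0 (_ : _ - _ = v ^+ 2 * (1 / 20 + 13 / 20 * v
      - 6 / 25 * v ^+ 2 + 4 / 25 * (v ^+ 2 * v))).
    by apply: mulr_ge0 => //; nra.
  by rewrite /p; field.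
apply: le_trans pp _; rewrite ler_wpM2r//; first lra.
by rewrite (exprM _ 2 2) ler_pXn2r// nnegrE (le_trans p0).
Qed.

Lemma superh_unit_step x i b (v := (radius2 (x + unit_step i b) - radius2 x)
    / radius2 x) :
  superh (x + unit_step i b) <= superh x * (1 - v / 4 + 11 / 64 * v ^+ 2).
Proof.
have s0 := radius2_gt0 x; have s1 := radius2_gt0 (x + unit_step i b).
have sv : radius2 (x + unit_step i b) = radius2 x * (1 + v).
  by rewrite /v; field; rewrite gt_eqF.
have xi := radius2_ge x i.
have [v1 v2] : - (1 / 16) <= v /\ v <= 1 / 16.
  rewrite /v radius2_unit_step addrAC subrr add0r.
  set t := (x ord0 i)%:~R in xi *.
  have := sqr_ge0 (t - 16); have := sqr_ge0 (t + 16).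
  rewrite ler_pdivlMr// ler_pdivrMr//; case: b {v sv s1} => ? ?; split; nra.
have q0 : 0 <= 1 - v / 4 + 11 / 64 * v ^+ 2 by have := sqr_ge0 v; lra.
rewrite -(@ler_pXn2r _ 4) ?nnegrE ?mulr_ge0 ?superh_ge0//.
rewrite exprMn !superh4 sv invfM ler_pM2l ?invr_gt0//.
rewrite -[leLHS]mul1r ler_pdivrMr; last lra.
exact: quarter_power_bound.
Qed.

(** With [s] for [radius2 x], the relative increment [v] of [s] has mean [1 / s]
    and second moment at most about [4 / (d s)].  So the mean of [s ^ (-1/4)]
    changes by the factor [1 + (- 1/4 + (5/8) / d) / s] to leading order, which is
    less than [1] as soon as [d] is at least [3]. *)
Lemma superh_superharmonic (x : T) : (3 <= d)%N ->
  (2 * d)%N%:R^-1 * \sum_(i < d) \sum_(b : bool) superh (x + unit_step i b)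
    + defect x <= superh x.
Proof.
move=> d3; have s0 := radius2_gt0 x; have sn0 : radius2 x != 0 by rewrite gt_eqF.
have d3R : 3 <= d%:R :> R by rewrite (ler_nat _ 3).
have h0 := superh_gt0 x; set s := radius2 x in s0 sn0 *.
have step i : \sum_(b : bool) superh (x + unit_step i b) <= superh x *
    (2 - 1 / (2 * s) + 11 / 64 * (2 + 8 * (x ord0 i)%:~R ^+ 2) / s ^+ 2).
  rewrite big_bool; apply: le_trans (lerD (superh_unit_step x i true)
    (superh_unit_step x i false)) _.
  have addKx (a b : R) : a + b - a = b by ring.
  rewrite !radius2_unit_step !addKx -/s.
  by rewrite -mulrDr le_eqVlt; apply/orP; left; apply/eqP; field.
apply: (@le_trans _ _ ((2 * d)%N%:R^-1 * (superh x *
    (d%:R * (2 - 1 / (2 * s)) + 11 / 64 * (2 * d%:R + 8 * (s - 1000)) / s ^+ 2))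
    + defect x)).
  rewrite lerD2r ler_wpM2l ?invr_ge0//.
  apply: le_trans (ler_sum _ (fun i _ => step i)) _.
  rewrite -mulr_sumr ler_pM2l//.
  rewrite (eq_bigr (fun i : 'I_d => (2 - 1 / (2 * s) + 11 / 64 * 2 / s ^+ 2) +
    11 / 64 * 8 / s ^+ 2 * (x ord0 i)%:~R ^+ 2)); last by move=> i _; field.
  rewrite big_split/= sumr_const card_ord -mulr_sumr -mulr_natl.
  have -> : \sum_(i < d) (x ord0 i)%:~R ^+ 2 = s - 1000 by rewrite /s /radius2; ring.
  by rewrite le_eqVlt; apply/orP; left; apply/eqP; field.
have wh : defect x <= superh x * (1 / (48 * s)).
  rewrite /defect -/s; have := superh_ge x; rewrite -/s => hs.
  rewrite (_ : (48 * s ^+ 2)^-1 = s^-1 * (1 / (48 * s))); last by field.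
  by rewrite ler_wpM2r// divr_ge0// mulr_ge0// ltW.
apply: le_trans (lerD (lexx _) wh) _.
rewrite [X in X + _]mulrCA -mulrDr; apply: ler_piMr; first exact: ltW.
rewrite -subr_ge0.
have -> : 1 - ((2 * d)%N%:R^-1 * (d%:R * (2 - 1 / (2 * s)) +
     11 / 64 * (2 * d%:R + 8 * (s - 1000)) / s ^+ 2) + 1 / (48 * s)) =
  (11 / 16) * (((d%:R - 3) * s / 3 + 1000 - d%:R / 4) / (d%:R * s ^+ 2)).
  by rewrite natrM; field; rewrite sn0 /= gt_eqF//; lra.
have s1000 : 1000 <= s by exact: radius2_ge1000.
apply: mulr_ge0; first lra.
by apply: divr_ge0; [nra|rewrite mulr_ge0// sqr_ge0].
Qed.

Lemma defect_gt0 x : 0 < defect x.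
Proof. by rewrite invr_gt0 mulr_gt0// exprn_gt0// radius2_gt0. Qed.

Lemma esum_defect (x z : T) : (3 <= d)%N ->
  (\esum_(p in [set: seq T]) (step_prob x p * defect (last x p - z))%:E <= 1)%E.
Proof.
move=> d3; apply: (@le_trans _ _ (superh (x - z))%:E); last first.
  by rewrite lee_fin superh_le1.
apply: (@esum_superharmonic _ _ (fun y => superh (y - z)) (fun y => defect (y - z))).
- by move=> y; exact/ltW/superh_gt0.
- by move=> y; exact/ltW/defect_gt0.
- move=> y; apply: le_trans (superh_superharmonic (y - z) d3).
  rewrite lerD2r ler_wpM2l ?invr_ge0//.
  by apply: ler_sum => i _; apply: ler_sum => b _; rewrite addrAC.
Qed.

(** A visit to [z] collects [defect 0], and the total collected is at most [1]:
    the Green function of the walk is bounded by the inverse of [defect 0]. *)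
Lemma green_bounded : (3 <= d)%N -> exists2 G : R, 0 < G &
  forall x z : T, (\esum_(p in [set p | last x p = z]) (step_prob x p)%:E <= G%:E)%E.
Proof.
move=> d3; have w0 := defect_gt0 0; exists (defect 0)^-1; first by rewrite invr_gt0.
move=> x z; have -> : (\esum_(p in [set p | last x p = z]) (step_prob x p)%:E =
    \esum_(p in [set p | last x p = z])
      ((defect 0)^-1%:E * (step_prob x p * defect (last x p - z))%:E))%E.
  apply: eq_esum => p /= ->; rewrite subrr -EFinM; congr EFin.
  by rewrite mulrCA mulVf ?mulr1// gt_eqF.
rewrite esumZl; [|by rewrite invr_ge0 ltW|]; last first.
  by move=> p; rewrite lee_fin mulr_ge0 ?step_prob_ge0// ltW ?defect_gt0.
rewrite -[leRHS]mule1 lee_wpmul2l//; first by rewrite lee_fin invr_ge0 ltW.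
by apply: le_trans (esum_defect x z d3); apply: esum_subset.
Qed.

End transience.

(** * Time spent against sites visited *)

Section seq_splitting.
Context {T : eqType}.
Implicit Types (x y z : T) (p : seq T).

Lemma last_take x p m : (m <= size p)%N -> last x (take m p) = nth x (x :: p) m.
Proof.
move=> mp; rewrite (last_nth x) size_takel//.
by rewrite (_ : x :: take m p = take m.+1 (x :: p))// nth_take.
Qed.

Lemma belast_take x p m : (m <= size p)%N -> belast x (take m p) = take m (x :: p).
Proof. by elim: p x m => [|a p IH] x [|m]//= mp; rewrite IH. Qed.

Lemma index_last_cat x p q : last x p \notin belast x p ->
  index (last x p) (x :: p ++ q) = size p.
Proof.
move=> nin; rewrite -cat_cons lastI cat_rcons index_cat (negPf nin)/= eqxx.
by rewrite size_belast addn0.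
Qed.

End seq_splitting.

Section loop_excision.
Context {R : realType} {d : nat}.
Local Notation T := 'rV[int]_d.
Implicit Types (x y z : T) (p : seq T) (v : T -> R).

Definition first_hits x y : set (seq T) :=
  [set p | last x p = y /\ y \notin belast x p].

(** The end point is left out because its potential is not charged. *)
Definition range_size x p : nat := size (undup (belast x p)).

Lemma esum_const_seq (S : choiceType) (s : seq S) (c : R) : 0 <= c ->
  (\esum_(i in [set` s]) c%:E = ((size (undup s))%:R * c)%:E)%E.
Proof.
move=> c0; rewrite (_ : [set` s] = [set` undup s]); last first.
  by apply/seteqP; split => i /=; rewrite mem_undup.
rewrite esum_fset; [|by apply/finite_seqP; exists (undup s)|by []].
by rewrite -fsbig_seq ?undup_uniq// sumEFin big_const_seq count_predT iter_addr_0 mulr_natl.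
Qed.

(** Erasing the loop made between the first visit of [z] and the visit at time [m]
    is injective on paths marked at a time, once the erased loop and [z] are
    remembered; so the time spent along a path costs, per visited site, at most
    the total weight of the loops at that site. *)
Lemma loop_excision (G : R) v x y : 0 <= G ->
  (forall z, (\esum_(q in [set q | last z q = z]) (step_prob z q)%:E <= G%:E)%E) ->
  (forall z, 0 <= v z) ->
  (\esum_(p in first_hits x y) ((size p)%:R * path_weight v x p)%:E <=
   G%:E *
     \esum_(p in first_hits x y) ((range_size x p)%:R * path_weight v x p)%:E)%E.
Proof.
move=> g0 green v0.
have w0 z p : 0 <= path_weight v z p by exact: path_weight_ge0.
apply: (@le_trans _ _ (\esum_(k in [set k : seq T * nat | first_hits x y k.1 /\
    [set` iota 0 (size k.1)] k.2]) (path_weight v x k.1)%:E)%E).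
  rewrite (@esum_pair _ _ _ (first_hits x y) (fun p => [set` iota 0 (size p)])
    (fun p _ => (path_weight v x p)%:E)); last by move=> p _; rewrite lee_fin.
  apply: le_esum => p _.
  by rewrite esum_const_seq// (undup_id (iota_uniq _ _)) size_iota.
(* [pos] is the site occupied at the marked time, [t] the time of its first
   visit, and [e] sends a marked path to the excised path, the site and the loop. *)
pose pos (k : seq T * nat) := nth x (x :: k.1) k.2.
pose t k := index (pos k) (x :: k.1).
pose loop k := drop (t k) (take k.2 k.1).
pose e k := (take (t k) k.1 ++ drop k.2 k.1, (pos k, loop k)).
pose P : set (seq T * nat) := [set k | first_hits x y k.1 /\ [set` iota 0 (size k.1)] k.2].
have splitP k : P k -> [/\ (t k <= k.2)%N, (k.2 < size k.1)%N,
    k.1 = take (t k) k.1 ++ loop k ++ drop k.2 k.1,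
    last x (take (t k) k.1) = pos k & last (pos k) (loop k) = pos k].
  case: k => p m [_ /=]; rewrite mem_iota add0n => /= mp.
  have tm : (t (p, m) <= m)%N.
    rewrite leqNgt; apply/negP => mt; have := before_find x mt.
    by rewrite /= eqxx.
  have pE : p = take (t (p, m)) p ++ loop (p, m) ++ drop m p.
    rewrite catA -[in LHS](cat_take_drop m p); congr cat.
    by rewrite -[in LHS](cat_take_drop (t (p, m)) (take m p)) take_takel.
  have lt : last x (take (t (p, m)) p) = pos (p, m).
    rewrite last_take ?(leq_trans tm (ltnW mp))// nth_index// mem_nth//.
    exact: leqW.
  split=> //; rewrite -[X in last X _]lt -last_cat.
  have -> : take (t (p, m)) p ++ loop (p, m) = take m p.
    by rewrite -[in RHS](cat_take_drop (t (p, m)) (take m p)) take_takel.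
  by rewrite last_take ?(ltnW mp).
have tE k : P k -> t k = index (pos k) (x :: (e k).1) /\ size (take (t k) k.1) = t k.
  move=> Pk; have [tm mp kE lt ll] := splitP k Pk.
  have st : size (take (t k) k.1) = t k by rewrite size_takel// (leq_trans tm (ltnW mp)).
  split=> //; have := @index_last_cat _ x (take (t k) k.1) (drop k.2 k.1).
  rewrite lt st /= => -> //; rewrite belast_take ?(leq_trans tm (ltnW mp))//.
  by rewrite in_take ?ltnn// mem_nth//; exact: leqW.
pose Q : set (seq T * (T * seq T)) := [set l | first_hits x y l.1 /\
  [set l2 | [set` undup (belast x l.1)] l2.1 /\ [set q | last l2.1 q = l2.1] l2.2] l.2].
have PQ k : P k -> Q (e k).
  move=> Pk; have [tm mp kE lt ll] := splitP k Pk; have [[ly yn] _] := Pk.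
  move: ly yn; rewrite {1 2}kE last_cat last_cat lt ll => ly.
  rewrite belast_cat belast_cat lt ll !mem_cat !negb_or => /and3P[y1 _ y2].
  split=> /=; first by split; rewrite ?last_cat ?belast_cat ?lt// mem_cat negb_or y1.
  split=> //; rewrite mem_undup belast_cat lt mem_cat.
  case: (drop k.2 k.1) (size_drop k.2 k.1) => [|a r] /=; last by rewrite inE eqxx orbT.
  by move=> /esym/eqP; rewrite subn_eq0 leqNgt mp.
have einj : set_inj P e.
  move=> k l /set_mem Pk /set_mem Pl ekl.
  have [tm mp kE _ _] := splitP k Pk; have [tm' mp' lE _ _] := splitP l Pl.
  have [tk sk] := tE k Pk; have [tl sl] := tE l Pl.
  have tkl : t k = t l by rewrite tk tl -[pos k]/(e k).2.1 -[pos l]/(e l).2.1 ekl.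
  move: (ekl) => [/eqP + _ lkl]; rewrite eqseq_cat; last by rewrite sk sl.
  case/andP => /eqP e1 /eqP e2.
  have m1 : k.2 = (t k + size (loop k))%N.
    by rewrite /loop size_drop (size_takel (ltnW mp)) (subnKC tm).
  have m2 : l.2 = (t l + size (loop l))%N.
    by rewrite /loop size_drop (size_takel (ltnW mp')) (subnKC tm').
  rewrite (surjective_pairing k) (surjective_pairing l) {1}kE e1 e2 lkl -lE.
  by rewrite m1 m2 tkl lkl.
apply: (@le_trans _ _ (\esum_(k in P)
    (step_prob (e k).2.1 (e k).2.2 * path_weight v x (e k).1)%:E)%E).
  apply: le_esum => k Pk; have [tm mp kE lt ll] := splitP k Pk.
  rewrite lee_fin {1}kE /= !path_weight_cat lt ll mulrCA.
  by apply: ler_wpM2r; [exact: mulr_ge0|exact: path_weight_le].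
apply: le_trans (@esum_inj_le _ _ _ _ _ _ (fun l => (step_prob l.2.1 l.2.2 *
  path_weight v x l.1)%:E) einj PQ) _.
have s0 z p : 0 <= step_prob z p :> R by exact: step_prob_ge0.
rewrite (@esum_pair _ _ _ (first_hits x y) (fun p =>
    [set l2 | [set` undup (belast x p)] l2.1 /\ [set q | last l2.1 q = l2.1] l2.2])
  (fun p l2 => (step_prob l2.1 l2.2 * path_weight v x p)%:E)); last first.
  by move=> p l2; rewrite lee_fin mulr_ge0.
rewrite -esumZl//; last by move=> p; rewrite lee_fin mulr_ge0.
apply: le_esum => p _.
rewrite (@esum_pair _ _ _ [set` undup (belast x p)] (fun z => [set q | last z q = z])
  (fun z q => (step_prob z q * path_weight v x p)%:E)); last first.
  by move=> z q; rewrite lee_fin mulr_ge0.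
apply: (@le_trans _ _ (\esum_(z in [set` undup (belast x p)])
    (G * path_weight v x p)%:E)%E).
  apply: le_esum => z _.
  under eq_esum do rewrite mulrC EFinM.
  rewrite esumZl//; last by move=> q; rewrite lee_fin.
  by rewrite (EFinM G) [leRHS]muleC; apply: lee_wpmul2l; [rewrite lee_fin|exact: green].
rewrite esum_const_seq ?mulr_ge0// undup_id ?undup_uniq//.
by rewrite -EFinM lee_fin mulrCA.
Qed.

End loop_excision.

(** * Expectations over the walk as sums over paths *)

Section nth_sums.
Context {R : realType} {d : nat}.
Local Notation T := 'rV[int]_d.

Lemma step_probE (y a : T) p : step_prob a p =
  \prod_(k < size p) srw_step R (nth y (a :: p) k) (nth y (a :: p) k.+1).
Proof.
elim: p a => [|b p IH] a /=; first by rewrite big_ord0.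
by rewrite big_ord_recl IH.
Qed.

Lemma sum_belastE (v : T -> R) (y a : T) p :
  \sum_(z <- belast a p) v z = \sum_(m < size p) v (nth y (a :: p) m).
Proof.
elim: p a => [|b p IH] a /=; first by rewrite big_nil big_ord0.
by rewrite big_cons big_ord_recl IH.
Qed.

End nth_sums.

Section walk_expectations.
Context {R : realType} {d : nat} {dW : measure_display} {W : measurableType dW}
  {PW : probability W R} {S : nat -> W -> 'rV[int]_d} {x : 'rV[int]_d}.
Hypothesis walkS : simple_random_walk PW S x.
Local Notation T := 'rV[int]_d.

Lemma hitting_timeP (y : T) (w : W) n : hitting_time S y w = Some n <->
  S n w = y /\ forall m, (m < n)%N -> S m w != y.
Proof.
rewrite /hitting_time; case: pselect => [ex|nex]; last first.
  by split => // -[Sn _]; exfalso; apply: nex; exists n; apply/eqP.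
case: ex_minnP => m /eqP Sm mmin; split=> [[<-]|[Sn nmin]].
  by split=> // k; rewrite ltnNge; apply: contra => /mmin.
congr Some; apply/eqP; rewrite eqn_leq mmin ?Sn ?eqxx//= leqNgt.
by apply/negP => /nmin; rewrite Sm eqxx.
Qed.

Let event (y : T) (k : T * seq T) : set W :=
  [set w | forall i, (i <= size k.2)%N -> S i w = nth y (k.1 :: k.2) i].

Let measurable_event y k : measurable (event y k).
Proof.
rewrite (_ : event y k = \bigcap_i (if (i <= size k.2)%N
    then [set w | S i w = nth y (k.1 :: k.2) i] else setT)); last first.
  apply/seteqP; split=> w /=; first by move=> Ew i _; case: ifP => // /Ew.
  by move=> Ew i ik; have := Ew i I; rewrite ik.
apply: bigcapT_measurable => i; case: ifP => // _; exact: srw_measurable walkS _ _.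
Qed.

(** The event [H(y) < oo] splits into the countably many events that the walk
    follows a given path up to its first visit of [y], whose probabilities are
    given by the finite-dimensional laws.  Such a path is indexed by its starting
    point together with its later points, and only the starting point [x] has
    positive probability. *)
Lemma walk_expectationE (v : T -> R) (y : T) (g : nat -> R) (X : W -> \bar R) :
  (forall n, 0 <= g n) ->
  (forall w n, hitting_time S y w = Some n -> X w = (g n)%:E) ->
  killed_expectation PW S v y X =
  (\esum_(p in first_hits x y) (g (size p) * path_weight v x p)%:E)%E.
Proof.
move=> g0 Xg; pose Q : set (T * seq T) := [set k | first_hits k.1 y k.2].
pose c (k : T * seq T) : R := g (size k.2) * expR (- \sum_(z <- belast k.1 k.2) v z).
have c0 k : 0 <= c k by rewrite mulr_ge0 ?expR_ge0.
rewrite /killed_expectation (eq_integral (fun w =>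
  \esum_(k in Q) ((c k)%:E * (\1_(event y k) w)%:E))%E); last first.
  move=> w _; rewrite /survival_weight.
  have evQ k : Q k -> event y k w -> hitting_time S y w = Some (size k.2) /\
     k = (S 0 w, [seq S i w | i <- iota 1 (size k.2)]).
    case: k => a p [/= ly yn] Ew; split.
      apply/hitting_timeP; split=> [|m mp].
        by rewrite Ew// -(last_nth y).
      rewrite Ew ?(ltnW mp)//; apply: contra yn => /eqP <- /=.
      by rewrite lastI nth_rcons size_belast mp mem_nth// size_belast.
    have a0 : a = S 0 w by rewrite (Ew 0%N).
    congr pair => //=.
    apply: (@eq_from_nth _ y) => [|i ip]; first by rewrite size_map size_iota.
    by rewrite (nth_map 0%N) ?size_iota// nth_iota// add1n Ew.
  case ht: (hitting_time S y w) => [n|]; last first.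
    rewrite mule0 esum1// => k Qk; rewrite indicE memNset ?mule0//= => Ew.
    by have [] := evQ k Qk Ew; rewrite ht.
  have [Sn nmin] := (hitting_timeP y w n).1 ht.
  pose k0 := (S 0 w, [seq S i w | i <- iota 1 n]).
  have nthk i : (i <= n)%N -> nth y (k0.1 :: k0.2) i = S i w.
    move=> i_n; rewrite -[k0.1 :: k0.2]/[seq S i w | i <- iota 0 n.+1].
    by rewrite (nth_map 0%N) ?size_iota// nth_iota.
  have sk : size k0.2 = n by rewrite size_map size_iota.
  have Ek : event y k0 w by move=> i; rewrite sk => i_n; rewrite nthk.
  have Qk : Q k0.
    split; first by rewrite (last_nth y) sk nthk.
    apply/negP => /(nthP y)[m]; rewrite size_belast sk => mn.
    have -> : nth y (belast k0.1 k0.2) m = nth y (k0.1 :: k0.2) m.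
      by rewrite lastI nth_rcons size_belast sk mn.
    by rewrite nthk ?(ltnW mn)// => /eqP; apply/negP/nmin.
  rewrite (esumID [set k0]); last by move=> k _; rewrite mule_ge0// lee_fin.
  rewrite setIC (_ : [set k0] `&` Q = [set k0]); last first.
    by apply/seteqP; split=> [k []//|k ->].
  rewrite esum_set1; last by rewrite mule_ge0// lee_fin.
  rewrite esum1 ?adde0; last first.
    move=> k [Qk' /= kk0]; rewrite indicE memNset ?mule0//= => Ew.
    have [] := evQ k Qk' Ew; rewrite ht => -[nk] kE; apply: kk0.
    by rewrite kE -nk.
  rewrite indicE mem_set// mule1 (Xg _ _ ht) -EFinM /c sk; congr (_ * expR (- _))%:E.
  rewrite (sum_belastE _ y) sk; apply: eq_bigr => i _.
  by rewrite nthk// ltnW.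
rewrite integral_esum; first last.
- by move=> k w; rewrite mule_ge0// lee_fin.
- by move=> k; apply/measurable_EFinP/measurable_funM => //; exact: measurable_indic.
have PWE k : PW (event y k) = ((k.1 == x)%:R * step_prob k.1 k.2)%:E.
  rewrite /event (srw_law walkS (size k.2) (nth y (k.1 :: k.2)))/=.
  by rewrite (step_probE y).
rewrite (eq_esum (b := fun k => (c k * ((k.1 == x)%:R * step_prob k.1 k.2))%:E)); last first.
  move=> k Qk; rewrite ge0_integralZl//.
  - by rewrite integral_indic//= setIT -[LHS]/((c k)%:E * PW (event y k))%E PWE -EFinM.
  - by apply/measurable_EFinP; exact: measurable_indic.
  - by rewrite lee_fin.
rewrite (esumID [set k | k.1 = x]); last first.
  by move=> k _; rewrite lee_fin !mulr_ge0 ?step_prob_ge0.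
rewrite [X in (_ + X)%E]esum1 ?adde0; last first.
  by move=> k [_ /= /eqP/negPf ->]; rewrite mul0r mulr0.
transitivity (\esum_(k in (fun p => (x, p)) @` first_hits x y)
    (c k * ((k.1 == x)%:R * step_prob k.1 k.2))%:E)%E.
  congr (esum _ _); apply/seteqP; split=> [[a p] [Qap /= ax]|_ [p Pp <-]].
    by exists p; rewrite -ax.
  by split.
rewrite esum_image; last by move=> p q _ _ [].
apply: eq_esum => p _; rewrite /= eqxx mul1r /c /path_weight.
by rewrite -mulrA [X in _ * X]mulrC.
Qed.

End walk_expectations.

(** * Independence and the law of the potential *)

Import HBNNSimple.

Section decoupling.
Context {R : realType} {dO : measure_display} {Omega : measurableType dO}
  {P : probability Omega R}.

Lemma decoupling_sfun (X : Omega -> R) d (U : measurableType d) (Z : {RV P >-> U}) (c : R)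
    (g : {nnsfun U >-> R}) :
  measurable_fun setT X -> (forall w, 0 <= X w) -> 0 <= c ->
  (forall B, measurable B -> (\int[P]_w (X w * \1_B (Z w))%:E = c%:E * P (Z @^-1` B))%E) ->
  (\int[P]_w (X w * g (Z w))%:E = c%:E * \int[P]_w (g (Z w))%:E)%E.
Proof.
move=> mX X0 c0 XB.
have mgr r : measurable (g @^-1` [set r]) by [].
have mi r : measurable_fun setT (fun w => \1_(g @^-1` [set r]) (Z w) : R).
  by apply: (measurableT_comp (f := \1_(g @^-1` [set r]) : U -> R)) => //; exact: measurable_indic.
have i0 r w : 0 <= r * \1_(g @^-1` [set r]) (Z w).
  by rewrite -lee_fin EFinM nnfun_muleindic_ge0.
have mXi r : measurable_fun setT (fun w => (X w * \1_(g @^-1` [set r]) (Z w))%:E).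
  exact/measurable_EFinP/measurable_funM.
have mii r : measurable_fun setT (fun w => (\1_(g @^-1` [set r]) (Z w))%:E : \bar R).
  exact/measurable_EFinP.
transitivity (\int[P]_w (\sum_(r \in range g)
    (r * (X w * \1_(g @^-1` [set r]) (Z w)))%:E))%E.
  apply: eq_integral => w _; rewrite [in LHS]fimfunE mulr_fsumr -fsumEFin//.
  by apply: eq_fsbigr => r _; rewrite mulrCA.
transitivity (c%:E * \int[P]_w (\sum_(r \in range g)
    (r * \1_(g @^-1` [set r]) (Z w))%:E))%E; last first.
  by congr (_ * _)%E; apply: eq_integral => w _; rewrite [in RHS]fimfunE -fsumEFin.
rewrite ge0_integral_fsum//; last 2 first.
- move=> r; under eq_fun do rewrite EFinM; exact: measurable_funeM.
- by move=> r w _; rewrite lee_fin mulrCA mulr_ge0.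
rewrite ge0_integral_fsum//; last 2 first.
- move=> r; under eq_fun do rewrite EFinM; exact: measurable_funeM.
- by move=> r w _; rewrite lee_fin.
rewrite ge0_mule_fsumr; last by move=> r; apply: integral_ge0 => w _; rewrite lee_fin.
apply: eq_fsbigr => r /set_mem [t _ <-].
have gt0 : (0 <= (g t)%:E)%E by rewrite lee_fin.
under eq_integral do rewrite EFinM.
under [in RHS]eq_integral do rewrite EFinM.
rewrite ge0_integralZl//; last by move=> w _; rewrite lee_fin mulr_ge0.
rewrite ge0_integralZl// XB// muleCA; congr (_ * (_ * _))%E.
transitivity (\int[P]_w (\1_(Z @^-1` (g @^-1` [set g t])) w)%:E)%E => //.
by rewrite integral_indic ?setIT//= -[X in measurable X]setTI; exact: measurable_funP.
Qed.

(** If [X] decouples from the events [Z \in B], it decouples from every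
    nonnegative function of [Z]: approximate the function by simple ones. *)
Lemma decoupling (X : Omega -> R) d (U : measurableType d) (Z : {RV P >-> U})
    (c : R) (f : U -> R) :
  measurable_fun setT X -> (forall w, 0 <= X w) -> 0 <= c ->
  (forall B, measurable B -> (\int[P]_w (X w * \1_B (Z w))%:E = c%:E * P (Z @^-1` B))%E) ->
  measurable_fun setT f -> (forall t, 0 <= f t) ->
  (\int[P]_w (X w * f (Z w))%:E = c%:E * \int[P]_w (f (Z w))%:E)%E.
Proof.
move=> mX X0 c0 XB mf f0.
have mfE : measurable_fun setT (EFin \o f) by exact/measurable_EFinP.
pose a := nnsfun_approx measurableT mfE.
have a_f t : (a n t)%:E @[n --> \oo] --> (f t)%:E.
  by apply: (@cvg_nnsfun_approx _ _ _ _ measurableT _ mfE) => // u _; rewrite /= lee_fin.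
have nda t : {homo (fun n => a n t) : m n / (m <= n)%N >-> m <= n}.
  by move=> m n mn; exact: (lefP _ _ (nd_nnsfun_approx measurableT mfE mn)).
have maZ n : measurable_fun setT (fun w => a n (Z w)).
  by apply: (measurableT_comp (f := a n)).
have cvgX : (\int[P]_w (X w * a n (Z w))%:E @[n --> \oo] -->
    \int[P]_w (X w * f (Z w))%:E)%E.
  rewrite [X in _ --> X](_ : _ = \int[P]_w limn (fun n => (X w * a n (Z w))%:E))%E.
    apply: cvg_monotone_convergence => //.
    - by move=> n; exact/measurable_EFinP/measurable_funM.
    - by move=> n w _; rewrite lee_fin mulr_ge0.
    - by move=> w _ m n mn; rewrite lee_fin ler_wpM2l// nda.
  apply: eq_integral => w _; apply/esym/cvg_lim => //.
  by rewrite EFinM; under eq_fun do rewrite EFinM; exact: cvgeZl.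
have cvgf : (\int[P]_w (a n (Z w))%:E @[n --> \oo] --> \int[P]_w (f (Z w))%:E)%E.
  rewrite [X in _ --> X](_ : _ = \int[P]_w limn (fun n => (a n (Z w))%:E))%E.
    apply: cvg_monotone_convergence => //.
    - by move=> n; exact/measurable_EFinP.
    - by move=> n w _; rewrite lee_fin.
    - by move=> w _ m n mn; rewrite lee_fin nda.
  by apply: eq_integral => w _; apply/esym/cvg_lim.
have e n := @decoupling_sfun X _ _ Z c (a n) mX X0 c0 XB.
have cvgc : (\int[P]_w (X w * a n (Z w))%:E @[n --> \oo] -->
    c%:E * \int[P]_w (f (Z w))%:E)%E.
  by rewrite (eq_cvg _ _ e); exact: cvgeZl.
exact: (cvg_unique _ cvgX cvgc).
Qed.

End decoupling.

Section product_expectation.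
Context {R : realType} {dO : measure_display} {Omega : measurableType dO}
  {P : probability Omega R} {I : choiceType} {V : I -> {RV P >-> R}}.
Hypothesis indepV : mutually_independent V.

Lemma measurable_prod_RV (s : seq I) (f : I -> R -> R) :
  (forall z, measurable_fun setT (f z)) ->
  measurable_fun setT (fun w => \prod_(z <- s) f z (V z w)).
Proof.
move=> mf; elim: s => [|z s IH].
  by under eq_fun do rewrite big_nil; exact: measurable_cst.
under eq_fun do rewrite big_cons.
by apply: measurable_funM => //; exact: measurableT_comp.
Qed.

(** Independence is given for events only; indicators are replaced by [f] one
    coordinate at a time. *)
Lemma expectation_prod (f : R -> R) (m : R) (s1 s2 : seq I) (B : I -> set R) :
  measurable_fun setT f -> (forall t, 0 <= f t) -> 0 <= m ->
  (forall z, \int[P]_w (f (V z w))%:E = m%:E)%E ->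
  uniq (s1 ++ s2) -> (forall z, measurable (B z)) ->
  (\int[P]_w (\prod_(z <- s1) f (V z w) * \prod_(z <- s2) \1_(B z) (V z w))%:E =
   (m ^+ size s1)%:E * \prod_(z <- s2) P (V z @^-1` B z))%E.
Proof.
move=> mf f0 m0 mE; elim: s1 s2 B => [|z s1 IH] s2 B.
  move=> us mB; rewrite expr0 mul1e -indepV//.
  transitivity (\int[P]_w (\1_[set w | forall z, z \in s2 -> B z (V z w)] w)%:E)%E.
    apply: eq_integral => w _; rewrite big_nil mul1r; congr EFin.
    have [ex|nex] := pselect (forall z, z \in s2 -> B z (V z w)).
      rewrite indicE mem_set// big_seq big1// => z zs.
      by rewrite indicE mem_set//; exact: ex.
    rewrite indicE memNset//.
    have [z [zs nz]] : exists z, z \in s2 /\ ~ B z (V z w).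
      apply: contrapT => H; apply: nex => z zs; apply: contrapT => nB.
      by apply: H; exists z.
    by rewrite (big_rem z)//= indicE memNset// mul0r.
  rewrite integral_indic ?setIT//.
  rewrite (_ : [set w | _] = \bigcap_(z in [set` s2]) (V z @^-1` B z)); last first.
    by apply/seteqP; split => w.
  apply: fin_bigcap_measurable => // z _.
  by rewrite -[X in measurable X]setTI; exact: measurable_funP.
move=> us mB.
pose X w := \prod_(z <- s1) f (V z w) * \prod_(z <- s2) \1_(B z) (V z w).
pose q := (\prod_(z <- s2) fine (P (V z @^-1` B z)))%R.
have qE : (\prod_(z <- s2) P (V z @^-1` B z) = q%:E)%E.
  rewrite /q; elim: (s2) => [|a s IHs]; first by rewrite !big_nil.
  by rewrite !big_cons IHs EFinM fineK// fin_num_measure// -[X in measurable X]setTI; exact: measurable_funP.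
under eq_integral do rewrite big_cons -mulrA mulrC.
rewrite (@decoupling _ _ _ _ X _ _ (V z) (m ^+ size s1 * q) f)//.
- by rewrite mE qE /= -!EFinM exprS; congr EFin; ring.
- apply: measurable_funM; first exact: (@measurable_prod_RV _ (fun=> f)).
  by apply: (@measurable_prod_RV _ (fun z => \1_(B z))) => a; exact: measurable_indic.
- by move=> w; rewrite mulr_ge0// prodr_ge0.
- by rewrite mulr_ge0 ?exprn_ge0// prodr_ge0// => a _; rewrite fine_ge0.
move=> C mC.
have zs2 : z \notin s2 by move: us; rewrite /= mem_cat negb_or => /andP[/andP[]].
pose B' a := if a == z then C else B a.
have B'E a : a \in s2 -> B' a = B a.
  by rewrite /B'; case: eqP => // ->; rewrite (negPf zs2).
have B'z : B' z = C by rewrite /B' eqxx.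
have us' : uniq (s1 ++ [:: z] ++ s2) by rewrite uniq_catCA.
have := IH (z :: s2) B' us'; rewrite big_cons B'z => IH'.
transitivity (\int[P]_w (\prod_(a <- s1) f (V a w) *
    \prod_(a <- z :: s2) \1_(B' a) (V a w))%:E)%E.
  apply: eq_integral => w _; rewrite big_cons B'z /X; congr EFin.
  rewrite mulrAC mulrA; congr (_ * _); apply: eq_big_seq => a as2.
  by rewrite B'E.
rewrite IH'; last by move=> a; rewrite /B'; case: ifP.
rewrite EFinM -muleA; congr (_ * _)%E; rewrite muleC -qE; congr (_ * _)%E.
by apply: eq_big_seq => a as2; rewrite B'E.
Qed.

Lemma expectation_prod_uniq (f : R -> R) (m : R) (s : seq I) :
  measurable_fun setT f -> (forall t, 0 <= f t) -> 0 <= m ->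
  (forall z, \int[P]_w (f (V z w))%:E = m%:E)%E -> uniq s ->
  (\int[P]_w (\prod_(z <- s) f (V z w))%:E = (m ^+ size s)%:E)%E.
Proof.
move=> mf f0 m0 mE us; have := @expectation_prod f m s [::] (fun=> setT) mf f0 m0 mE.
rewrite cats0 big_nil mule1 => <- //.
by apply: eq_integral => w _; rewrite big_nil mulr1.
Qed.

End product_expectation.

Section RV_to_borel.
Context {R : realType} {dO : measure_display} {Omega : measurableType dO}
  {P : probability Omega R}.

(** A random variable seen with values in the measurable space on which
    Lebesgue-Stieltjes measures are defined. *)
Definition borelRV (X : {RV P >-> R}) : Omega -> measurableTypeR R := X.

Let measurable_borelRV X : measurable_fun setT (borelRV X).
Proof. by move=> mT B mB; exact: (measurable_funP X) mT B mB. Qed.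

HB.instance Definition _ X :=
  @isMeasurableFun.Build _ _ Omega (measurableTypeR R) (borelRV X) (measurable_borelRV X).

End RV_to_borel.

Lemma probability_ocitv (R : realType) (Q : probability (measurableTypeR R) R)
    (a b : R) : a <= b ->
  (Q `]a, b]%classic = Q `]-oo, b]%classic - Q `]-oo, a]%classic)%E.
Proof.
move=> ab; have -> : (Q `]-oo, b]%classic = Q `]-oo, a]%classic + Q `]a, b]%classic)%E.
  rewrite -measureU//; first by congr (Q _); rewrite -itv_bndbnd_setU.
  by apply/seteqP; split=> // x []/=; rewrite !in_itv/= => xa /andP[]; rewrite ltNge xa.
by rewrite [X in (X - _)%E]addeC addeK// fin_num_measure.
Qed.

Section potential_law.
Context {R : realType} {d : nat} {F : cumulativeBounded (0 : R) (1 : R)}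
  {dO : measure_display} {Omega : measurableType dO} {P : probability Omega R}
  {V : 'rV[int]_d -> {RV P >-> R}}.
Hypothesis iidV : iid_potential F V.

(** Both measures are determined by their values on half-open intervals, which
    are differences of rays, where the distribution function gives both. *)
Lemma potential_law z (A : set (measurableTypeR R)) : measurable A ->
  distribution P (borelRV (V z)) A = lebesgue_stieltjes_measure F A.
Proof.
move=> mA; apply/esym.
apply: lebesgue_stieltjes_measure_unique => [I [[a b]]/= _ <- | //].
have [ab|ba] := leP a b; last first.
  by rewrite set_itv_ge ?measure0// bnd_simp -leNgt ltW.
have ray r : lebesgue_stieltjes_measure F `]-oo, r]%classic =
    distribution P (borelRV (V z)) `]-oo, r]%classic.
  by rewrite -[RHS]/(cdf (V z) r) (potential_cdf iidV); exact: cdf_lebesgue_stieltjes_id.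
apply: etrans (probability_ocitv (lebesgue_stieltjes_measure F) ab) _.
apply: etrans _ (esym (probability_ocitv (distribution P (borelRV (V z))) ab)).
by congr (_ - _)%E; exact: ray.
Qed.

Lemma expectation_potential z (f : measurableTypeR R -> R) :
  measurable_fun setT f -> (forall t, 0 <= f t) ->
  (\int[P]_w (f (V z w))%:E = \int[lebesgue_stieltjes_measure F]_t (f t)%:E)%E.
Proof.
move=> mf f0.
rewrite -(@eq_measure_integral _ _ _ _ _ (distribution P (borelRV (V z)))); last first.
  move=> A mA _. exact: potential_law.
by rewrite ge0_integral_distribution//; exact/measurable_EFinP.
Qed.

End potential_law.

(** * Monotone lattice paths *)

Section lattice_routes.
Context {d : nat}.
Local Notation T := 'rV[int]_d.
Implicit Types (x y z a b : T) (p : seq T).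

Definition adjacent x y : bool := l1norm (y - x) == 1%N.

Definition crd x (i : 'I_d) : int := x ord0 i.

Lemma crdP x y : (forall i, crd x i = crd y i) -> x = y.
Proof. by move=> xy; apply/matrixP => k i; rewrite ord1; exact: xy. Qed.

Lemma l1normE x : l1norm x = (\sum_(i < d) absz (crd x i))%N.
Proof. by []. Qed.

Lemma crdD x y (i : 'I_d) : crd (x + y) i = crd x i + crd y i.
Proof. exact: mxE. Qed.

Lemma crdB x y (i : 'I_d) : crd (x - y) i = crd x i - crd y i.
Proof. by rewrite crdD /crd mxE. Qed.

Lemma unit_stepE (i j : 'I_d) (b : bool) :
  crd (unit_step i b) j = if j == i then (if b then 1 else -1) else 0.
Proof.
by rewrite /crd /unit_step; case: b; rewrite !mxE eqxx/=; case: eqP.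
Qed.

Lemma adjacentP x y : reflect (exists i (b : bool), y = x + unit_step i b) (adjacent x y).
Proof.
apply: (iffP eqP) => [/l1norm_eq1[i [b yx]]|[i [b ->]]].
  by exists i, b; rewrite -yx addrC subrK.
rewrite addrAC subrr add0r l1normE (bigD1 i)//= unit_stepE eqxx big1 ?addn0.
  by case: b.
by move=> j /negPf ji; rewrite unit_stepE ji.
Qed.

Lemma adjacent_coord x y j : adjacent x y -> (`|crd y j - crd x j| <= 1)%N.
Proof.
move=> /adjacentP[i [b ->]]; rewrite crdD unit_stepE; case: ifP => _; case: b; lia.
Qed.

Definition between x z a : Prop := forall j,
  (crd x j <= crd a j <= crd z j) || (crd z j <= crd a j <= crd x j).

Let monotone_step (D E : int) : 0 <= E -> (E = 0 -> D = 0) -> 0 <= D * E ->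
  0 <= D * (E + 1).
Proof.
move=> E0 ED DE; have [/ED->|En0] := eqVneq E 0; first by rewrite mul0r.
have Ep : 0 < E by lia.
by move: DE; rewrite pmulr_lge0// => D0; rewrite mulr_ge0//; lia.
Qed.

(** The last clause says that the path is monotone, jointly in all coordinates;
    this is what later keeps suitable translates of one path disjoint. *)
Lemma route_exists x z : exists p,
  [/\ path adjacent x p, last x p = z, uniq (x :: p), size p = l1norm (z - x) &
      (forall a, a \in x :: p -> between x z a) /\
      (forall a b, a \in x :: p -> b \in x :: p ->
        (forall j, 0 <= (crd b j - crd a j) * (crd z j - crd x j)) \/
        (forall j, (crd b j - crd a j) * (crd z j - crd x j) <= 0))].
Proof.
have [n] := ubnP (l1norm (z - x)); elim: n x => // n IH x xn.
have [->|zx] := eqVneq z x.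
  exists [::]; split => //.
  - by rewrite subrr /l1norm big1// => j _; rewrite mxE.
  split; first by move=> a; rewrite inE => /eqP -> j; rewrite lexx.
  by move=> a b; rewrite !inE => /eqP -> /eqP ->; left => j; rewrite subrr mul0r.
have [i zxi] : exists i, crd z i != crd x i.
  apply/existsP; apply: contraNT zx; rewrite negb_exists => /forallP zx.
  by apply/eqP/crdP => j; have := zx j; rewrite negbK => /eqP.
pose b := crd x i < crd z i; pose x' := x + unit_step i b.
have x'i : crd x' i = crd x i + (if b then 1 else -1).
  by rewrite crdD unit_stepE eqxx.
have x'j j : j != i -> crd x' j = crd x j.
  by move=> /negPf ji; rewrite crdD unit_stepE ji addr0.
have nE : l1norm (z - x) = (l1norm (z - x')).+1.
  rewrite !l1normE (bigD1 i)//= [in RHS](bigD1 i)//= -addSn; congr addn.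
    by rewrite !crdB x'i /b; case: ltrP zxi; lia.
  by apply: eq_bigr => j ji; rewrite !crdB x'j.
have [|p [px lp up sp [bp mp]]] := IH x'; first by rewrite -ltnS -nE.
have bet a : a \in x' :: p -> between x z a /\ crd a i != crd x i.
  move=> /bp bxa; split=> [j|]; last first.
    by have := bxa i; rewrite x'i /b; case: ltrP zxi; lia.
  have [->|ji] := eqVneq j i; last by have := bxa j; rewrite x'j.
  by have := bxa i; rewrite x'i /b; case: ltrP zxi; lia.
have mono (a c : T) : a \in x' :: p -> c \in x' :: p ->
    (forall j, 0 <= (crd c j - crd a j) * (crd z j - crd x j)) \/
    (forall j, (crd c j - crd a j) * (crd z j - crd x j) <= 0).
  move=> ax cx; have ba := bp a ax i; have bc := bp c cx i.
  have [m|m] := mp a c ax cx; [left|right] => j;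
    (have [->|ji] := eqVneq j i; last by have := m j; rewrite x'j);
    move: ba bc zxi (m i); rewrite x'i /b;
    (have [D Dd] : {D : int | D = crd c i - crd a i} by eexists);
    rewrite -Dd; case: ltrP => xz ba bc zxi mi.
  - suff: 0 <= D * ((crd z i - (crd x i + 1)) + 1) by lia.
    by apply: monotone_step; [lia|move=> ?; lia|lia].
  - suff: 0 <= (- D) * ((- (crd z i - (crd x i - 1))) + 1) by lia.
    by apply: monotone_step; [lia|move=> ?; lia|lia].
  - suff: 0 <= (- D) * ((crd z i - (crd x i + 1)) + 1) by lia.
    by apply: monotone_step; [lia|move=> ?; lia|lia].
  - suff: 0 <= D * ((- (crd z i - (crd x i - 1))) + 1) by lia.
    by apply: monotone_step; [lia|move=> ?; lia|lia].
exists (x' :: p); split.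
- by rewrite /= px andbT; apply/adjacentP; exists i, b.
- by [].
- rewrite cons_uniq up andbT; apply/negP => /bet[_]; by rewrite eqxx.
- by rewrite /= sp nE.
- split.
    move=> a; rewrite inE => /predU1P[->|/bet[]//] j.
    by case: (lerP (crd x j) (crd z j)) => // h; lia.
  have head a : a \in x' :: p -> forall j,
      0 <= (crd a j - crd x j) * (crd z j - crd x j).
    by move=> /bet[ba _] j; have := ba j; nia.
  move=> a c; rewrite inE => /predU1P[->|ax]; rewrite inE => /predU1P[->|cx].
  + by left => j; rewrite subrr mul0r.
  + by left; exact: head.
  + by right => j; have := head a ax j; nia.
  + exact: mono.
Qed.

End lattice_routes.

Lemma step_prob_adjacent (R : realType) (d : nat) (x : 'rV[int]_d) p :
  path adjacent x p -> step_prob x p = (2 * d)%N%:R^-1 ^+ size p :> R.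
Proof.
elim: p x => [|a p IH] x /=; first by rewrite expr0.
by rewrite /srw_step => /andP[xa /IH ->]; rewrite -/(adjacent x a) xa exprS.
Qed.

Lemma step_prob_neq0 (R : realType) (d : nat) (x : 'rV[int]_d) p :
  step_prob x p != 0 :> R -> path adjacent x p.
Proof.
elim: p x => [//|a p IH] x /=; rewrite mulf_eq0 negb_or /srw_step -/(adjacent x a).
by case: ifP => [_ /andP[_ /IH]//|]; rewrite eqxx.
Qed.

(** * Averaged weights *)

Section annealed.
Context {R : realType} {d : nat} {F : cumulativeBounded (0 : R) (1 : R)}
  {dO : measure_display} {Omega : measurableType dO} {P : probability Omega R}
  {V : 'rV[int]_d -> {RV P >-> R}}.
Hypothesis iidV : iid_potential F V.
Local Notation T := 'rV[int]_d.
Implicit Types (x y z : T) (p : seq T).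
Local Notation phi := (laplace1 F).

Let V_ge0 z w : 0 <= V z w.
Proof. exact: potential_ge0 iidV z w. Qed.

Lemma measurable_expRN : measurable_fun setT (fun t : R => expR (- t)).
Proof. exact: measurableT_comp. Qed.

Lemma measurable_expRNV z : measurable_fun setT (fun w => expR (- V z w)).
Proof. exact: measurableT_comp measurable_expRN _. Qed.

Lemma expectation_expRN z : (\int[P]_w (expR (- V z w))%:E = phi%:E)%E.
Proof.
rewrite /laplace1 /Rintegral fineK -(expectation_potential iidV z (f := fun t => expR (- t)))//;
  try by [exact: measurable_expRN|move=> t; exact: expR_ge0].
rewrite ge0_fin_numE; last by apply: integral_ge0 => w _; rewrite lee_fin expR_ge0.
apply: (@le_lt_trans _ _ (\int[P]_w (cst 1 w))%E); last first.
  by rewrite integral_cst// mul1e; apply: le_lt_trans (ltry 1); exact: probability_le1.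
apply: ge0_le_integral => //.
- by apply/measurable_EFinP; exact: measurable_expRNV.
- by move=> w _; rewrite lee_fin -[leRHS]expR0 ler_expR oppr_le0 V_ge0.
Qed.

Lemma probability_ae_False : ~ {ae P, forall w, False}.
Proof.
rewrite /prop_near1 /= => /negligibleP; rewrite setC0.
move=> /(_ measurableT) P0; have := etrans (esym (probability_setT P)) P0.
by move/eqP; rewrite onee_eq0.
Qed.

Lemma laplace1_gt0 : 0 < phi.
Proof.
rewrite lt_neqAle; apply/andP; split; last first.
  rewrite -lee_fin -(expectation_expRN 0); apply: integral_ge0 => w _.
  by rewrite lee_fin expR_ge0.
apply/eqP => phi0; apply: probability_ae_False.
have mE : measurable_fun setT (fun w => (expR (- V 0 w))%:E).
  by apply/measurable_EFinP; exact: measurable_expRNV.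
have /(ae_eq_integral_abs P measurableT mE) : (\int[P]_w `|(expR (- V 0 w))%:E| = 0)%E.
  under eq_integral do rewrite gee0_abs ?lee_fin ?expR_ge0//.
  by rewrite expectation_expRN -phi0.
apply: filterS => w /(_ I) /eqP; rewrite eqe => /eqP e0.
by have := expR_gt0 (- V 0 w); rewrite e0 ltxx.
Qed.

Lemma laplace1_lt1 : F 0 < 1 -> phi < 1.
Proof.
move=> F0; rewrite ltNge; apply/negP => phi1.
have mE : measurable_fun setT (fun w => (expR (- V 0 w))%:E).
  by apply/measurable_EFinP; exact: measurable_expRNV.
have mD : measurable_fun setT (fun w => (1 - expR (- V 0 w))%:E).
  by apply/measurable_EFinP/measurable_funB => //; exact: measurable_expRNV.
have D0 w : 0 <= 1 - expR (- V 0 w).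
  by rewrite subr_ge0 -[leRHS]expR0 ler_expR oppr_le0.
have I1 : (\int[P]_w (1 - expR (- V 0 w))%:E + phi%:E = 1)%E.
  rewrite -(expectation_expRN 0) -ge0_integralD//; last first.
    by move=> w _; rewrite lee_fin.
  under eq_integral do rewrite -EFinD subrK.
  by rewrite integral_cst// mul1e; exact: probability_setT.
have /(ae_eq_integral_abs P measurableT mD) ae0 :
    (\int[P]_w `|(1 - expR (- V 0 w))%:E| = 0)%E.
  under eq_integral do rewrite gee0_abs ?lee_fin//.
  apply/eqP; rewrite eq_le integral_ge0 ?andbT; last by move=> w _; rewrite lee_fin.
  rewrite -(@leeD2rE _ phi%:E)// add0e I1.
  by rewrite lee_fin.
have mA : measurable (V 0 @^-1` `]-oo, 0]).
  by rewrite -[X in measurable X]setTI; exact: measurable_funP.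
have : P (~` (V 0 @^-1` `]-oo, 0])) = 0%E.
  apply/negligibleP; first exact: measurableC.
  apply: negligibleS ae0 => w /= nV /(_ I) /eqP; rewrite eqe subr_eq0 => /eqP e1.
  apply: nV; rewrite in_itv/= -[leLHS]opprK oppr_le0 -ler_expR -e1 expR0//.
rewrite probability_setC// -[P _]/(cdf (V 0) 0) (potential_cdf iidV) => /eqP.
by rewrite -EFinB eqe subr_eq0 => /eqP F01; rewrite -F01 ltxx in F0.
Qed.

Lemma measurable_path_weight x p :
  measurable_fun setT (fun w => path_weight (V ^~ w) x p).
Proof.
apply: measurable_funM => //; apply: measurableT_comp => //.
by apply: measurableT_comp => //; apply: measurable_sum.
Qed.

Lemma sum_undup_le (s : seq T) (f : T -> R) : (forall z, 0 <= f z) ->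
  \sum_(z <- undup s) f z <= \sum_(z <- s) f z.
Proof.
move=> f0; elim: s => [|a s IH] /=; first by rewrite !big_nil.
rewrite big_cons; case: ifP => _; last by rewrite big_cons lerD2l.
by apply: le_trans IH _; rewrite lerDr.
Qed.

Lemma expectation_prod_expRN (s : seq T) : uniq s ->
  (\int[P]_w (\prod_(z <- s) expR (- V z w))%:E = (phi ^+ size s)%:E)%E.
Proof.
move=> us; apply: (expectation_prod_uniq (potential_indep iidV)
  (f := fun t => expR (- t))) => //.
- exact: measurable_expRN.
- exact/ltW/laplace1_gt0.
- exact: expectation_expRN.
Qed.

Lemma expectation_step_prob x p (s : seq T) : uniq s ->
  (\int[P]_w (step_prob x p * expR (- \sum_(z <- s) V z w))%:E =
   (step_prob x p * phi ^+ size s)%:E)%E.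
Proof.
move=> us; under eq_integral do rewrite -sumrN expR_sum EFinM.
rewrite ge0_integralZl ?expectation_prod_expRN//.
- apply/measurable_EFinP; apply: (@measurable_prod_RV _ _ _ _ _ _ _ (fun _ t => expR (- t))).
  by move=> z; exact: measurable_expRN.
- by move=> w _; rewrite lee_fin prodr_ge0// => z _; exact: expR_ge0.
- by rewrite lee_fin step_prob_ge0.
Qed.

(** Each visited site is charged at least once, and the potentials at distinct
    sites are independent. *)
Lemma expectation_weight_le x p :
  (\int[P]_w (path_weight (V ^~ w) x p)%:E <=
   (step_prob x p * phi ^+ range_size x p)%:E)%E.
Proof.
rewrite /range_size -expectation_step_prob ?undup_uniq//.
apply: ge0_le_integral => //.
- by move=> w _; rewrite lee_fin path_weight_ge0.
- by apply/measurable_EFinP; exact: measurable_path_weight.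
- apply/measurable_EFinP; apply: measurable_funM => //; apply: measurableT_comp => //.
  by apply: measurableT_comp => //; apply: measurable_sum.
- move=> w _; rewrite lee_fin ler_wpM2l ?step_prob_ge0// ler_expR lerN2.
  exact: sum_undup_le.
Qed.

Lemma expectation_weight_uniq x p : uniq (belast x p) ->
  (\int[P]_w (path_weight (V ^~ w) x p)%:E = (step_prob x p * phi ^+ size p)%:E)%E.
Proof. by move=> ub; rewrite -(size_belast x p) -expectation_step_prob. Qed.

End annealed.

(** * The annealed bound *)

(** The maximum of [r * expR (- (l * r))] is at [l^-1]; the decrease beyond it
    follows from [1 + u <= expR u] without differentiation. *)
Lemma mul_expR_le (R : realType) (l A r : R) : 0 < l -> l^-1 <= A -> A <= r ->
  r * expR (- (l * r)) <= A * expR (- (l * A)).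
Proof.
move=> l0 lA Ar; have il0 : 0 < l^-1 by rewrite invr_gt0.
have A0 : 0 < A by lra.
have -> : expR (- (l * A)) = expR (- (l * r)) * expR (l * (r - A)).
  by rewrite -expRD; congr expR; ring.
rewrite mulrCA [leLHS]mulrC ler_pM2l ?expR_gt0//.
apply: (@le_trans _ _ (A * (1 + l * (r - A)))); last first.
  by rewrite ler_pM2l// expR_ge1Dx.
have lA1 : 1 <= A * l by rewrite -(mulVf (lt0r_neq0 l0)) ler_wpM2r// ltW.
nra.
Qed.

Section annealed_bound.
Context {R : realType} {d : nat} {F : cumulativeBounded (0 : R) (1 : R)}
  {dO : measure_display} {Omega : measurableType dO} {P : probability Omega R}
  {V : 'rV[int]_d -> {RV P >-> R}} {dW : measure_display} {W : measurableType dW}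
  {PW : probability W R} {S : nat -> W -> 'rV[int]_d}.
Hypothesis iidV : iid_potential F V.
Hypothesis walkS : simple_random_walk PW S 0.
Hypothesis d3 : (3 <= d)%N.
Hypothesis F01 : F 0 < 1.
Variable G : R.
Hypothesis G0 : 0 < G.
Hypothesis green : forall x z : 'rV[int]_d,
  (\esum_(p in [set p | last x p = z]) (step_prob x p)%:E <= G%:E)%E.
Local Notation T := 'rV[int]_d.
Local Notation phi := (laplace1 F).
Local Notation rate := (- ln phi).

Let phi_gt0 : 0 < phi. Proof. exact: laplace1_gt0 iidV. Qed.
Let phi_lt1 : phi < 1. Proof. exact: laplace1_lt1 iidV F01. Qed.
Let rate_gt0 : 0 < rate. Proof. by rewrite oppr_gt0 ln_lt0// phi_gt0. Qed.
Let d0 : 0 < (2 * d)%N%:R :> R. Proof. by rewrite ltr0n muln_gt0/= (leq_trans _ d3). Qed.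

Let ln2d_ge1 : 1 <= ln (2 * d)%N%:R :> R.
Proof.
rewrite -(ler_expR) lnK//; apply: (@le_trans _ _ 6); last by rewrite (ler_nat _ 6); lia.
(* [expR (- 1 / 2) >= 1 / 2], hence [expR 1 <= 4] *)
have h1 := expR_ge1Dx (- (1 / 2) : R); have h2 := expR_gt0 (1 / 2 : R).
have h3 : expR (1 / 2) * expR (- (1 / 2)) = 1 :> R by rewrite expRxMexpNx_1.
have -> : 1 = 1 / 2 + 1 / 2 :> R by field.
rewrite expRD; have : expR (1 / 2) <= 2 :> R by nra.
by nra.
Qed.

Let phiE n : phi ^+ n = expR (- (rate * n%:R)).
Proof. by rewrite mulNr opprK mulrC expRM_natl lnK. Qed.

(** After excision of loops it suffices to bound the averaged number of visited
    sites.  Up to [A] sites, the bound is [A] times the averaged crossing weight.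
    A path with more sites has averaged weight at most [phi ^ A] per unit of
    probability, which by the choice of [A] is the averaged weight [B] of a
    shortest path, so these paths add at most [A * B] per visit of [y]. *)
Lemma annealed_hitting_le (y : T) : y != 0 ->
  (annealed_expectation PW S P (fun x => V x) y (extended_hitting_time R S y)
     / (l1norm y)%:R%:E
   <= (G * (1 + G) * (1 / rate) * (ln (2 * d)%N%:R - ln phi))%:E)%E.
Proof.
move=> y0; set n := l1norm y; have rate0 := rate_gt0; have ln1 := ln2d_ge1.
have n0 : 0 < n%:R :> R.
  rewrite ltr0n lt0n; apply: contra y0 => /eqP ny; apply/eqP/crdP => i.
  move: ny; rewrite /n l1normE => /eqP; rewrite sum_nat_eq0 => /forallP/(_ i)/=.
  by rewrite absz_eq0 => /eqP ->; rewrite /crd mxE.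
(* [A] solves [phi ^ A = phi ^ n / (2 d) ^ n]. *)
pose A := n%:R * (rate + ln (2 * d)%N%:R) / rate.
have rA : rate * A = n%:R * (rate + ln (2 * d)%N%:R).
  by rewrite /A mulrC divfK// gt_eqF.
have A0 : 0 < A by rewrite /A divr_gt0// mulr_gt0//; lra.
have n1 : 1 <= n%:R :> R by rewrite (ler_nat _ 1) -(ltr0n R).
have Arate : rate^-1 <= A.
  rewrite -(ler_pM2l rate_gt0) rA mulfV ?gt_eqF//.
  by apply: mulr_ege1 => //; lra.
pose B := (2 * d)%N%:R^-1 ^+ n * phi ^+ n.
have BE : B = expR (- (rate * A)).
  rewrite /B phiE -{1}(lnK (x := (2 * d)%N%:R)) ?posrE// -expRN.
  by rewrite -expRM_natl -expRD rA; congr expR; ring.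
have B0 : 0 < B by rewrite BE expR_gt0.
pose FH := first_hits (0 : T) y.
pose e p := (\int[P]_w (path_weight (V ^~ w) 0 p)%:E)%E.
have e0 p : (0 <= e p)%E.
  by apply: integral_ge0 => w _; rewrite lee_fin path_weight_ge0.
have e_le p : (e p <= (step_prob 0 p)%:E)%E.
  apply: le_trans (expectation_weight_le iidV 0 p) _.
  by rewrite lee_fin ler_piMr ?step_prob_ge0// exprn_ile1// ltW.
have mw p : measurable_fun setT (fun w => (path_weight (V ^~ w) 0 p)%:E).
  by apply/measurable_EFinP; exact: measurable_path_weight.
have denE : (\int[P]_w crossing_weight PW S (V ^~ w) y = \esum_(p in FH) e p)%E.
  rewrite -integral_esum//; last by move=> p w; rewrite lee_fin path_weight_ge0.
  apply: eq_integral => w _.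
  rewrite /crossing_weight (@walk_expectationE _ _ _ _ _ _ _ walkS _ _ (fun=> 1))//.
  by apply: eq_esum => p _; rewrite mul1r.
have den_ge : (B%:E <= \esum_(p in FH) e p)%E.
  have [p [adj lp up sp _]] := route_exists 0 y.
  have FHp : FH p.
    by split=> //; move: up; rewrite lastI rcons_uniq lp => /andP[].
  apply: (@le_trans _ _ (e p)); last first.
    rewrite -[leLHS](esum_set1 (t := p)) //.
    by apply: esum_subset => q ->.
  rewrite /e (expectation_weight_uniq iidV); last first.
    by move: up; rewrite lastI rcons_uniq => /andP[].
  by rewrite lee_fin step_prob_adjacent// sp subr0.
have den_le : (\esum_(p in FH) e p <= G%:E)%E.
  apply: le_trans (green 0 y); apply: le_trans (le_esum (fun p _ => e_le p)) _.
  by apply: esum_subset => p [].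
have [r rE] : exists r, (\esum_(p in FH) e p = r%:E)%E.
  exists (fine (\esum_(p in FH) e p)); rewrite fineK//.
  by rewrite ge0_fin_numE ?esum_ge0//; exact: le_lt_trans den_le (ltry _).
have rB : B <= r by rewrite -lee_fin -rE.
have r0 : 0 < r by exact: lt_le_trans rB.
have ABq (p : seq T) : (0 <= (A * B)%:E * (step_prob 0 p)%:E)%E.
  rewrite -EFinM lee_fin; apply: mulr_ge0; last exact: step_prob_ge0.
  by apply: mulr_ge0; exact: ltW.
have key p : ((range_size 0 p)%:R%:E * e p <=
    A%:E * e p + (A * B)%:E * (step_prob 0 p)%:E)%E.
  have [RA|RA] := leP (range_size 0 p)%:R A.
    apply: (@le_trans _ _ (A%:E * e p)%E); first by rewrite lee_wpmul2r.
    by rewrite leeDl.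
  apply: (@le_trans _ _ ((A * B)%:E * (step_prob 0 p)%:E)%E); last first.
    by rewrite leeDr// mule_ge0// lee_fin ltW.
  apply: le_trans (lee_wpmul2l _ (expectation_weight_le iidV 0 p)) _ => //.
  rewrite -!EFinM lee_fin mulrCA [leRHS]mulrC ler_wpM2l ?step_prob_ge0//.
  by rewrite phiE BE mul_expR_le// ltW.
have num_le : (\int[P]_w killed_expectation PW S (V ^~ w) y
    (extended_hitting_time R S y) <= (G * (1 + G) * A * r)%:E)%E.
  have -> : (\int[P]_w killed_expectation PW S (V ^~ w) y (extended_hitting_time R S y)
      = \int[P]_w (\esum_(p in FH) ((size p)%:R * path_weight (V ^~ w) 0 p)%:E))%E.
    apply: eq_integral => w _.
    rewrite (@walk_expectationE _ _ _ _ _ _ _ walkS _ _ (fun k => k%:R))// => u k hk.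
    by rewrite /extended_hitting_time hk.
  apply: (@le_trans _ _ (\int[P]_w (G%:E *
      \esum_(p in FH) ((range_size 0 p)%:R * path_weight (V ^~ w) 0 p)%:E))%E).
    apply: ge0_le_integral => //.
    - by move=> w _; apply: esum_ge0 => p _; rewrite lee_fin mulr_ge0// path_weight_ge0.
    - apply: measurable_fun_esum => [p|p w]; last by rewrite lee_fin mulr_ge0// path_weight_ge0.
      by under eq_fun do rewrite EFinM; exact: measurable_funeM.
    - apply: measurable_funeM; apply: measurable_fun_esum => [p|p w].
        by under eq_fun do rewrite EFinM; exact: measurable_funeM.
      by rewrite lee_fin mulr_ge0// path_weight_ge0.
    - move=> w _; apply: loop_excision => //; first exact: ltW.
      by move=> z; exact: potential_ge0 iidV z w.
  rewrite ge0_integralZl//; first last.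
  - by rewrite lee_fin ltW.
  - by move=> w _; apply: esum_ge0 => p _; rewrite lee_fin mulr_ge0// path_weight_ge0.
  - apply: measurable_fun_esum => [p|p w]; last by rewrite lee_fin mulr_ge0// path_weight_ge0.
    by under eq_fun do rewrite EFinM; exact: measurable_funeM.
  rewrite integral_esum//; first last.
  - by move=> p w; rewrite lee_fin mulr_ge0// path_weight_ge0.
  - by move=> p; under eq_fun do rewrite EFinM; exact: measurable_funeM.
  rewrite -(mulrA G) -(mulrA G) EFinM lee_wpmul2l ?lee_fin ?(ltW G0)//.
  apply: (@le_trans _ _ (\esum_(p in FH)
      (A%:E * e p + (A * B)%:E * (step_prob 0 p)%:E))%E).
    apply: le_esum => p _; apply: le_trans (key p).
    under eq_integral do rewrite EFinM.
    rewrite ge0_integralZl//.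
    by move=> w _; rewrite lee_fin path_weight_ge0.
  have Ae (p : seq T) : (0 <= A%:E * e p)%E by rewrite mule_ge0// lee_fin ltW.
  rewrite (@esumD _ _ _ _ _ (fun p _ => Ae p) (fun p _ => ABq p)).
  have q0 (p : seq T) : (0 <= (step_prob 0 p)%:E :> \bar R)%E by rewrite lee_fin step_prob_ge0.
  rewrite (esumZl _ (ltW A0) e0) (esumZl _ (mulr_ge0 (ltW A0) (ltW B0)) q0).
  rewrite rE -EFinM.
  apply: (@le_trans _ _ ((A * r)%:E + (A * B)%:E * G%:E)%E).
    apply: leeD2l; apply: lee_wpmul2l.
      by rewrite lee_fin; apply: mulr_ge0; exact: ltW.
    by apply: le_trans (green 0 y); apply: esum_subset => p [].
  rewrite -EFinM -EFinD lee_fin.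
  have : A * B * G <= A * r * G by rewrite ler_pM2r// ler_pM2l.
  by nra.
rewrite /annealed_expectation denE rE !inver !gt_eqF// lee_pdivrMr// lee_pdivrMr//.
apply: le_trans num_le _; rewrite -!EFinM lee_fin ler_pM2r//.
rewrite /A le_eqVlt; apply/orP; left; apply/eqP.
by field; rewrite -oppr_eq0 gt_eqF.
Qed.

End annealed_bound.

(** * Cubes, spheres and connections *)

Section boxes.
Context {d : nat}.
Local Notation T := 'rV[int]_d.
Implicit Types (x y z a b u : T) (p : seq T).

Lemma crd_row (f : 'I_d -> int) j : crd (\row_k f k) j = f j.
Proof. exact: mxE. Qed.

Definition in_box (r : nat) y a : bool :=
  [forall j, (absz (crd a j - crd y j) <= r)%N].

Definition in_interior (r : nat) y a : bool :=
  [forall j, (absz (crd a j - crd y j) < r)%N].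

Definition in_sphere r y a : bool := in_box r y a && ~~ in_interior r y a.

Definition box_seq (r : nat) y : seq T :=
  [seq y + \row_j ((f j : nat)%:Z - r%:Z) | f : {ffun 'I_d -> 'I_(2 * r).+1}].

Definition sphere_seq r y : seq T := [seq a <- box_seq r y | ~~ in_interior r y a].

Lemma mem_box_seq r y a : (a \in box_seq r y) = in_box r y a.
Proof.
apply/mapP/forallP => [[f _ ->] j|ra].
  by rewrite crdD crd_row; move: (nat_of_ord (f j)) (ltn_ord (f j)) => k; lia.
have lt j : (absz (crd a j - crd y j + r%:Z)%R < (2 * r).+1)%N by have := ra j; lia.
exists [ffun j => Ordinal (lt j)]; first by rewrite mem_enum.
apply: crdP => j; rewrite crdD crd_row ffunE/=.
have := ra j; lia.
Qed.

Lemma mem_sphere_seq r y a : (a \in sphere_seq r y) = in_sphere r y a.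
Proof. by rewrite mem_filter mem_box_seq andbC. Qed.

Lemma size_box_seq r y : size (box_seq r y) = ((2 * r).+1 ^ d)%N.
Proof. by rewrite size_map -cardE card_ffun !card_ord. Qed.

Lemma size_sphere_seq r y : (size (sphere_seq r y) <= (2 * r).+1 ^ d)%N.
Proof. by rewrite -(size_box_seq r y) size_filter count_size. Qed.

Lemma interior_neighbor r y a b : adjacent a b -> in_interior r y b -> in_box r y a.
Proof.
move=> ab /forallP yb; apply/forallP => j.
by have := adjacent_coord j ab; have := yb j; lia.
Qed.

Lemma center_notin_sphere r y : (0 < r)%N -> in_sphere r y y = false.
Proof.
move=> r0; apply/negbTE; rewrite negb_and negbK; apply/orP; right.
by apply/forallP => j; rewrite subrr.
Qed.

(** A route that never changes a coordinate which is extreme for the cube cannot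
    enter the interior. *)
Lemma sphere_between r y u a (i : 'I_d) z :
  in_box r y u -> in_box r y z -> absz (crd u i - crd y i) = r -> crd z i = crd u i ->
  between u z a -> in_sphere r y a.
Proof.
move=> /forallP yu /forallP yz ui zi uza; apply/andP; split.
  by apply/forallP => j; have := uza j; have := yu j; have := yz j; lia.
apply/negP => /forallP/(_ i); have := uza i; rewrite zi; lia.
Qed.

Definition linked (A : pred T) x z : Prop := exists p,
  [/\ path adjacent x p, last x p = z & all A (x :: p)].

Lemma linked_trans (A : pred T) x y z : linked A x y -> linked A y z -> linked A x z.
Proof.
move=> [p [adp lp Ap]] [q [adq lq Aq]]; exists (p ++ q).
rewrite cat_path adp lp adq last_cat lp lq; split=> //.
by rewrite -cat_cons all_cat Ap; case/andP: Aq.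
Qed.

Lemma linked_sub (A B : pred T) x z : {subset A <= B} -> linked A x z -> linked B x z.
Proof.
move=> AB [p [adp lp Ap]]; exists p; split=> //; apply: sub_all Ap => a; exact: AB.
Qed.

Lemma linked_between (A : pred T) x z : (forall a, between x z a -> A a) -> linked A x z.
Proof.
move=> xzA; have [p [adp lp _ _ [bp _]]] := route_exists x z.
by exists p; split=> //; apply/allP => a /bp/xzA.
Qed.

Lemma between_sym x z a : between x z a -> between z x a.
Proof. by move=> xza j; rewrite orbC; exact: xza. Qed.

(** Keeping one extreme coordinate fixed while the others are raised to their
    maximum, and then raising that one, leads to the corner of the cube without
    leaving its surface. *)
Lemma sphere_linked r y u u' : (2 <= d)%N ->
  in_sphere r y u -> in_sphere r y u' -> linked (in_sphere r y) u u'.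
Proof.
move=> d2; pose c : T := \row_j (crd y j + r%:Z).
have cE j : crd c j = crd y j + r%:Z by rewrite crd_row.
suff H w : in_sphere r y w -> linked (in_sphere r y) w c /\ linked (in_sphere r y) c w.
  by move=> /H[uc _] /H[_ cu']; exact: linked_trans uc cu'.
move=> /andP[yw]; rewrite negb_forall => /existsP[i]; rewrite -leqNgt => wi.
have wir : absz (crd w i - crd y i) = r.
  by apply/eqP; rewrite eqn_leq wi andbT; exact: (forallP yw).
have [j ji] : exists j : 'I_d, j != i.
  have [->|i0] := eqVneq i (Ordinal (leq_trans (isT : (0 < 2)%N) d2)).
    by exists (Ordinal d2).
  by exists (Ordinal (leq_trans (isT : (0 < 2)%N) d2)); rewrite eq_sym.
pose m : T := \row_k (if k == i then crd w i else crd y k + r%:Z).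
have mE k : crd m k = if k == i then crd w i else crd y k + r%:Z.
  by rewrite crd_row.
have ym : in_box r y m.
  by apply/forallP => k; rewrite mE; case: eqP => [->|_]; [exact: (forallP yw)|lia].
have yc : in_box r y c by apply/forallP => k; rewrite cE; lia.
have wm a : between w m a -> in_sphere r y a.
  by apply: (@sphere_between r y w a i m) => //; rewrite mE eqxx.
have mc a : between m c a -> in_sphere r y a.
  apply: (@sphere_between r y m a j c) => //; first by rewrite mE (negPf ji); lia.
  by rewrite cE mE (negPf ji).
split; [apply: (@linked_trans _ _ m)|apply: (@linked_trans _ _ m)];
  apply: linked_between => a; first [exact: wm|exact: mc|
    by move=> /between_sym; first [exact: wm|exact: mc]].
Qed.

Lemma last_exit (I : pred T) x p : path adjacent x p -> ~~ I x -> I (last x p) ->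
  exists a b : seq T, [/\ p = a ++ b, ~~ I (last x a), all I b &
    adjacent (last x a) (head x b) && I (head x b)].
Proof.
elim/last_ind: p => [|p c IH] /=; first by move=> _ /negP.
rewrite rcons_path last_rcons => /andP[adp pc] nx Ic.
have [Ip|nIp] := boolP (I (last x p)); last first.
  by exists p, [:: c]; rewrite cats1/= Ic pc.
have [a [b [pab nIa Ib hb]]] := IH adp nx Ip.
exists a, (rcons b c); rewrite pab -rcons_cat; split=> //.
  by rewrite all_rcons Ic.
case: b pab Ib hb => [|e b] //= pab _ /andP[_ Ix]; by rewrite Ix in nx.
Qed.

Lemma first_entrance (I : pred T) x p : path adjacent x p -> ~~ I x -> I (last x p) ->
  exists (a : seq T) (b : T * seq T), [/\ p = rcons a b.1 ++ b.2, all (predC I) (x :: a), I b.1 &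
    adjacent (last x a) b.1].
Proof.
elim: p x => [|c p IH] x /=; first by move=> _ /negP.
move=> /andP[xc adp] nx Il; have [Ic|nIc] := boolP (I c).
  by exists [::], (c, p); rewrite /= nx.
have [a [b [-> na Ib lb]]] := IH c adp nIc Il.
by exists (c :: a), b; split=> //; apply/andP.
Qed.

Lemma linked_path_uniq (A : seq T) x z : linked (mem A) x z ->
  exists p, [/\ path adjacent x p, last x p = z, uniq (x :: p) & {subset x :: p <= A}].
Proof.
move=> [p [adp lp /allP Ap]]; case/shortenP: adp lp => q adq uq qp lq.
exists q; split=> // a; rewrite inE => /predU1P[->|/qp ap]; first exact/Ap/mem_head.
by apply: Ap; rewrite inE ap orbT.
Qed.

End boxes.

Section path_weight_lower.
Context {R : realType} {d : nat}.
Local Notation T := 'rV[int]_d.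

Lemma sum_subset_le (v : T -> R) (s A : seq T) : (forall z, 0 <= v z) ->
  uniq s -> {subset s <= A} -> \sum_(z <- s) v z <= \sum_(z <- A) v z.
Proof.
move=> v0; elim: s A => [|a s IH] A us sA; first by rewrite big_nil sumr_ge0.
have aA : a \in A by apply: sA; rewrite mem_head.
rewrite big_cons (perm_big _ (perm_to_rem aA)) big_cons lerD2l.
move: us => /andP[as_ us]; apply: IH => // b bs.
have ba : b != a by apply: contra as_ => /eqP <-.
have : b \in A by apply: sA; rewrite inE bs orbT.
by rewrite (perm_mem (perm_to_rem aA)) inE (negPf ba).
Qed.

(** A path without repetitions pays the potential of each site at most once, so
    its weight is bounded below by the total potential of any set containing it,
    whatever the path is. *)
Lemma path_weight_ge (v : T -> R) (A : seq T) x p : (0 < d)%N -> (forall z, 0 <= v z) ->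
  path adjacent x p -> uniq (x :: p) -> {subset x :: p <= A} ->
  expR (- (\sum_(z <- A) v z + ln (2 * d)%N%:R * (size A)%:R)) <= path_weight v x p.
Proof.
move=> d0 v0 adp up pA; rewrite opprD expRD mulrC /path_weight step_prob_adjacent//.
have d2 : 0 < (2 * d)%N%:R :> R by rewrite ltr0n muln_gt0.
have ub : uniq (belast x p) by move: up; rewrite lastI rcons_uniq => /andP[].
have bA : {subset belast x p <= A} by move=> a /mem_belast/pA.
apply: ler_pM; rewrite ?expR_ge0//; last first.
  by rewrite ler_expR lerN2; exact: sum_subset_le.
have -> : expR (- (ln (2 * d)%N%:R * (size A)%:R)) = (2 * d)%N%:R^-1 ^+ size A :> R.
  by rewrite -mulNr mulrC expRM_natl expRN lnK.
have sp : (size p <= size A)%N by rewrite -(size_belast x p); exact: uniq_leq_size.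
apply: ler_wiXn2l => //.
by rewrite invf_le1// (ler_nat _ 1) muln_gt0.
Qed.

End path_weight_lower.

(** * Cutting a crossing path near its end point *)

Section quenched_ratio.
Context {R : realType} {d : nat}.
Local Notation T := 'rV[int]_d.
Variables (v : T -> R) (y : T) (r : nat) (K : R) (c : R).
Hypothesis c0 : 0 < c.
Hypothesis r0 : (0 < r)%N.
Hypothesis K0 : 0 <= K.
Hypothesis y_far : ~~ in_box r y 0.
Hypothesis reach : forall u, in_sphere r y u -> exists p : seq T,
  [/\ last 0 p = u, y \notin 0 :: p & c <= path_weight v 0 p].

Let FH (u : T) : set (seq T) := first_hits u y.
Variable e : R.
Hypothesis eE : (\esum_(p in FH 0) (path_weight v 0 p)%:E = e%:E)%E.
Let far : set (seq T) := [set a | in_sphere r y (last 0 a) /\ K < (range_size 0 a)%:R].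

Let w0 u p : (0 <= (path_weight v u p)%:E)%E.
Proof. by rewrite lee_fin path_weight_ge0. Qed.

Let inward_le u : in_sphere r y u ->
  (\esum_(b in FH u) (path_weight v u b)%:E <= (c^-1 * e)%:E)%E.
Proof.
move=> /reach[p [lp yp cp]]; rewrite EFinM muleC -lee_pdivrMr ?invr_gt0//.
rewrite invrK muleC -eE.
apply: (@le_trans _ _ (\esum_(b in FH u) (path_weight v 0 (p ++ b))%:E)%E).
  rewrite -(esumZl _ (ltW c0) (w0 u)); apply: le_esum => b _.
  by rewrite -EFinM lee_fin path_weight_cat lp ler_wpM2r ?path_weight_ge0.
apply: (@esum_inj_le _ _ _ _ _ (fun b => p ++ b) (fun p => (path_weight v 0 p)%:E)).
  by move=> b b' _ _ /eqP; rewrite eqseq_cat// => /andP[_ /eqP].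
move=> b [lb yb]; split; first by rewrite last_cat lp.
rewrite belast_cat mem_cat lp negb_or yb andbT.
by apply: contra yp => /mem_belast.
Qed.

(** A crossing path is cut at its last point [u] on the sphere around [y].  After
    that it stays in the cube, hence visits few sites.  Before that it either
    visits at most [K] sites, or belongs to [far].  In the second case the part
    after [u] weighs at most [c^-1 * e] in total, because a path from [0] to [u] of
    weight [c] that avoids [y] extends it to a crossing path.  The potential near
    [y] thus enters only through [e]. *)
Lemma range_crossing_le :
  (\esum_(p in FH 0) ((range_size 0 p)%:R * path_weight v 0 p)%:E <=
   ((K + (size (box_seq r y))%:R) * e)%:E +
   (c^-1 * e)%:E * \esum_(a in far) ((range_size 0 a)%:R * path_weight v 0 a)%:E)%E.
Proof.
pose N : R := (size (box_seq r y))%:R.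
have split_ex p : exists ab : seq T * seq T, FH 0 p -> step_prob 0 p != 0 :> R ->
    [/\ p = ab.1 ++ ab.2, in_sphere r y (last 0 ab.1), FH (last 0 ab.1) ab.2 &
        (range_size 0 p <= range_size 0 ab.1 + size (box_seq r y))%N].
  have [[FHp sp]|nFH] := pselect (FH 0 p /\ step_prob 0 p != 0 :> R); last first.
    by exists ([::], [::]) => ? ?; exfalso; apply: nFH.
  have adp := step_prob_neq0 sp; have [lp yp] := FHp.
  have nI0 : ~~ in_interior r y 0.
    apply: contra y_far => /forallP yI; apply/forallP => j; exact: ltnW (yI j).
  have Iy : in_interior r y (last 0 p).
    by rewrite lp; apply/forallP => j; rewrite subrr.
  have [a [b [pab nIa Ib /andP[ab Ihb]]]] := last_exit adp nI0 Iy.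
  have boxa : in_box r y (last 0 a) by exact: interior_neighbor ab Ihb.
  exists (a, b) => _ _; rewrite /= pab; split=> //.
  - by rewrite /in_sphere boxa.
  - move: lp yp; rewrite pab last_cat belast_cat mem_cat negb_or => lp /andP[_ yb].
    by split.
  rewrite /range_size belast_cat -size_cat; apply: uniq_leq_size; first exact: undup_uniq.
  move=> z; rewrite mem_undup !mem_cat mem_undup => /orP[->//|/mem_belast].
  rewrite inE mem_box_seq => /predU1P[->|zb]; first by rewrite boxa orbT.
  apply/orP; right; apply/forallP => j; apply: ltnW.
  by have /forallP := allP Ib z zb; exact.
have [f fP] := choice split_ex.
pose good : set (seq T) := [set p | (FH 0 p /\ step_prob 0 p != 0 :> R) /\ far (f p).1].
pose g (ab : seq T * seq T) : \bar R :=
  ((range_size 0 ab.1)%:R * path_weight v 0 ab.1 * path_weight v (last 0 ab.1) ab.2)%:E.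
have e0 : 0 <= e by rewrite -lee_fin -eE; apply: esum_ge0 => p _; exact: w0.
have Rw0 a : (0 <= ((range_size 0 a)%:R * path_weight v 0 a)%:E)%E.
  by rewrite lee_fin mulr_ge0// path_weight_ge0.
have g0 ab : (0 <= g ab)%E.
  by rewrite lee_fin mulr_ge0// ?path_weight_ge0// -lee_fin; exact: Rw0.
have KN0 : 0 <= K + N by rewrite addr_ge0.
have goodK p : FH 0 p -> (((range_size 0 p)%:R * path_weight v 0 p)%:E <=
    (K + N)%:E * (path_weight v 0 p)%:E + (if p \in good then g (f p) else 0))%E.
  move=> FHp; have [sp0|sp0] := eqVneq (step_prob 0 p : R) 0.
    rewrite /path_weight sp0 !mul0r mulr0 mule0 add0e.
    by case: ifP => // _; exact: g0.
  have [pE sa FHb Rle] := fP p FHp sp0.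
  have RleR : (range_size 0 p)%:R <= (range_size 0 (f p).1)%:R + N.
    by rewrite -natrD ler_nat.
  have wp : 0 <= path_weight v 0 p by exact: path_weight_ge0.
  have [fa|nfa] := leP (range_size 0 (f p).1)%:R K.
    apply: (@le_trans _ _ ((K + N)%:E * (path_weight v 0 p)%:E)%E).
      by rewrite -EFinM lee_fin ler_wpM2r// (le_trans RleR)// lerD2r.
    by rewrite leeDl//; case: ifP => // _; exact: g0.
  rewrite mem_set//.
  rewrite /g -EFinM -mulrA -path_weight_cat -pE -EFinD lee_fin -mulrDl ler_wpM2r//.
  by rewrite (le_trans RleR)// addrC lerD2r lerDr.
apply: le_trans (le_esum goodK) _.
rewrite esumD; [|by move=> p _; rewrite mule_ge0|by move=> p _; case: ifP].
rewrite (esumZl _ KN0 (w0 0)) eE -EFinM; apply: leeD2l.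
rewrite -esum_mkcondr.
pose D : set (seq T * seq T) := [set ab | far ab.1 /\ FH (last 0 ab.1) ab.2].
apply: (@le_trans _ _ (\esum_(ab in D) g ab)%E).
  apply: (@esum_inj_le _ _ _ (FH 0 `&` good) D f g).
    move=> p q /set_mem [_ [[Fp sp] _]] /set_mem [_ [[Fq sq] _]] fpq.
    have [-> _ _ _] := fP p Fp sp; have [-> _ _ _] := fP q Fq sq.
    by rewrite fpq.
  by move=> p [_ [[Fp sp] fa]]; have [_ _ FHb _] := fP p Fp sp.
rewrite (@esum_pair _ _ _ far (fun a => FH (last 0 a)) (fun a b =>
  ((range_size 0 a)%:R * path_weight v 0 a * path_weight v (last 0 a) b)%:E)); last first.
  by move=> a b; exact: (g0 (a, b)).
have ce0 : 0 <= c^-1 * e by rewrite mulr_ge0// invr_ge0 ltW.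
rewrite -(esumZl _ ce0 Rw0); apply: le_esum => a [sa _].
under eq_esum do rewrite EFinM.
rewrite (esumZl _ _ (w0 _)); last by rewrite -lee_fin; exact: Rw0.
rewrite [leRHS]muleC; apply: lee_wpmul2l; first exact: Rw0.
exact: inward_le.
Qed.

End quenched_ratio.

(** * Reaching a sphere cheaply *)

Section reach_sphere.
Context {R : realType} {d : nat}.
Local Notation T := 'rV[int]_d.
Variables (v : T -> R) (y x : T) (r k : nat) (q : seq T) (c : R).
Hypothesis d2 : (2 <= d)%N.
Hypothesis v0 : forall z, 0 <= v z.
Hypothesis r0 : (0 < r)%N.
Hypothesis y_far : ~~ in_box r y 0.
Hypothesis kx : in_box k 0 x.
Hypothesis adq : path adjacent x q.
Hypothesis ry : in_box r y (last x q).
Hypothesis box_le : \sum_(z <- box_seq k 0) v z <= c.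
Hypothesis route_le : \sum_(z <- x :: q) v z <= c.
Hypothesis sphere_le : \sum_(z <- sphere_seq r y) v z <= c.

(** Follow a route [0] to [x] in the cube, then [q] until it first meets the cube
    around [y], then the sphere itself.  None of this visits [y], and removing
    repetitions keeps the path in the union of the three cheap sets. *)
Lemma reach_sphere u : in_sphere r y u -> exists p : seq T,
  [/\ last 0 p = u, y \notin 0 :: p &
      expR (- (3 * c + ln (2 * d)%N%:R *
        (size (box_seq k (0 : T)) + (size (x :: q) + size (sphere_seq r y)))%:R))
      <= path_weight v 0 p].
Proof.
move=> su; pose B := box_seq k 0 ++ x :: q.
pose A0 := box_seq k 0 ++ (x :: q) ++ sphere_seq r y.
pose A := [seq a <- A0 | a != y].
have memA0 a : (a \in A0) = (a \in B) || in_sphere r y a.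
  by rewrite !mem_cat mem_sphere_seq orbA.
have yy : in_box r y y by apply/forallP => j; rewrite subrr.
have sphereA a : in_sphere r y a -> a \in A.
  move=> sa; rewrite mem_filter memA0 sa orbT andbT.
  by apply: contraTneq sa => ->; rewrite center_notin_sphere.
have [p [adp lp Bp]] : linked (mem B) 0 (last x q).
  apply: (@linked_trans _ _ 0 x).
    apply: linked_between => a bxa; rewrite /= mem_cat mem_box_seq; apply/orP; left.
    apply/forallP => j; have := bxa j; have := forallP kx j.
    have -> : crd (0 : T) j = 0 by rewrite /crd mxE.
    by lia.
  exists q; split=> //; apply/allP => a aq; by rewrite /= mem_cat aq orbT.
have [a [b [pab na Ib lab]]] := first_entrance adp y_far (etrans (congr1 _ lp) ry).
have sb : in_sphere r y b.1.
  rewrite /in_sphere Ib; apply/negP => /(interior_neighbor lab).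
  by apply/negP/(allP na); exact: mem_last.
have lb : linked (mem A) 0 b.1.
  exists (rcons a b.1); rewrite last_rcons; split=> //.
    by move: adp; rewrite pab cat_path => /andP[].
  apply/allP => z; rewrite -rcons_cons mem_rcons inE => /predU1P[->|za].
    exact: sphereA.
  rewrite /= mem_filter memA0; apply/andP; split.
    by apply: contraTneq (allP na z za) => ->; rewrite /= yy.
  apply/orP; left; apply: (allP Bp); rewrite pab -cat_cons mem_cat.
  by rewrite -rcons_cons mem_rcons inE za orbT.
have lu : linked (mem A) b.1 u.
  by apply: linked_sub (sphere_linked d2 sb su) => z; exact: sphereA.
have [w [adw lw uw wA]] := linked_path_uniq (linked_trans lb lu).
exists w; split=> //; first by apply/negP => /wA; rewrite mem_filter eqxx.
apply: le_trans (path_weight_ge (ltnW d2) v0 adw uw wA).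
have d0 : 0 < (2 * d)%N%:R :> R by rewrite ltr0n muln_gt0 (ltnW d2).
rewrite ler_expR lerN2; apply: lerD; last first.
  rewrite ler_wpM2l//; first by rewrite ln_ge0// (ler_nat _ 1) muln_gt0 (ltnW d2).
  by rewrite ler_nat -!size_cat size_filter count_size.
apply: (@le_trans _ _ (\sum_(z <- A0) v z)).
  rewrite /A big_filter big_mkcond; apply: ler_sum => z _; by case: ifP.
rewrite !big_cat/=; have := box_le; have := route_le; have := sphere_le; lra.
Qed.

End reach_sphere.

(** * Sums of the potential over disjoint blocks *)

Section growth.
Context {R : realType}.

Lemma bernoulli_ge (b : R) k : 1 <= b -> 1 + k%:R * (b - 1) <= b ^+ k.
Proof.
move=> b1; elim: k => [|k IH]; first by rewrite mul0r addr0 expr0.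
rewrite exprS; apply: (@le_trans _ _ (b * (1 + k%:R * (b - 1)))).
  have := mulr_ge0 (ler0n R k) (sqr_ge0 (b - 1)); rewrite -natr1; nra.
by rewrite ler_wpM2l//; lra.
Qed.

Lemma poly_le_geometric (d : nat) (a : R) : 1 < a ->
  exists2 C : R, 0 < C & forall k, (4 * k + 3)%N%:R ^+ d <= C * a ^+ k.
Proof.
elim: d a => [|d IH] a a1.
  exists 1 => // k; rewrite expr0 mul1r; exact/exprn_ege1/ltW.
pose b := Num.sqrt a.
have b1 : 1 < b by rewrite -[ltLHS]sqrtr1 ltr_sqrt//; lra.
have bb : a = b * b by rewrite -expr2 sqr_sqrtr//; lra.
have [C C0 HC] := IH b b1.
have q0 : 0 < 4 / (b - 1) by rewrite divr_gt0//; lra.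
exists ((4 / (b - 1) + 3) * C) => [|k]; first by rewrite mulr_gt0//; lra.
rewrite exprS bb exprMn mulrACA; apply: ler_pM => //.
apply: (@le_trans _ _ ((4 / (b - 1) + 3) * (1 + k%:R * (b - 1)))); last first.
  by rewrite ler_wpM2l//; [lra|exact/bernoulli_ge/ltW].
rewrite natrD natrM.
have -> : (4 / (b - 1) + 3) * (1 + k%:R * (b - 1)) =
    4 * k%:R + 3 + (4 / (b - 1) + 3 * k%:R * (b - 1)).
  by field; rewrite subr_eq0 gt_eqF.
rewrite lerDl; apply: addr_ge0; first exact: ltW.
by apply: mulr_ge0; [exact: mulr_ge0|lra].
Qed.

End growth.

Section disjoint_sums.
Context {R : realType} {dO : measure_display} {Omega : measurableType dO}
  {P : probability Omega R} {I : choiceType} {V : I -> {RV P >-> R}}.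
Hypothesis indepV : mutually_independent V.
Variable mu : R.
Hypothesis mu0 : 0 <= mu.
Hypothesis V0 : forall z w, 0 <= V z w.
Hypothesis Vmu : forall z, (\int[P]_w (V z w)%:E = mu%:E)%E.

Definition apart (A B : seq I) : bool := ~~ has (mem A) B.

Lemma measurable_sum_V (A : seq I) :
  measurable_fun setT (fun w => \sum_(z <- A) V z w).
Proof. exact: measurable_sum. Qed.

Lemma measurable_prod_sums (As : seq (seq I)) :
  measurable_fun setT (fun w => \prod_(A <- As) \sum_(z <- A) V z w).
Proof.
elim: As => [|A As IH].
  by under eq_fun do rewrite big_nil; exact: measurable_cst.
under eq_fun do rewrite big_cons.
by apply: measurable_funM => //; exact: measurable_sum_V.
Qed.

(** Sums over disjoint blocks are independent; expanding the product, this only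
    uses the expectation of products of [V] at distinct sites. *)
Lemma expectation_prod_sums (As : seq (seq I)) (s : seq I) :
  pairwise apart As -> uniq s -> all (apart s) As ->
  (\int[P]_w ((\prod_(A <- As) \sum_(z <- A) V z w) * \prod_(z <- s) V z w)%:E =
   ((\prod_(A <- As) (size A)%:R) * mu ^+ (size As + size s))%:E)%E.
Proof.
elim: As s => [|A As IH] s /=.
  move=> _ us _; rewrite big_nil mul1r.
  transitivity (\int[P]_w (\prod_(z <- s) `|V z w|)%:E)%E.
    apply: eq_integral => w _; rewrite big_nil mul1r; congr EFin.
    by apply: eq_bigr => z _; rewrite ger0_norm.
  apply: (expectation_prod_uniq indepV (f := fun t => `|t|)) => //.
    by move=> z; rewrite -(Vmu z); apply: eq_integral => w _; rewrite ger0_norm.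
move=> /andP[/allP AAs pAs] us /andP[sA /allP sAs].
transitivity (\int[P]_w (\sum_(a <- A) ((\prod_(B <- As) \sum_(z <- B) V z w) *
    \prod_(z <- a :: s) V z w)%:E))%E.
  apply: eq_integral => w _; rewrite big_cons sumEFin; congr EFin.
  rewrite -mulr_sumr -mulrA mulrCA; congr (_ * _).
  by rewrite mulr_suml; apply: eq_bigr => a _; rewrite big_cons.
rewrite ge0_integral_sum//; last 2 first.
- move=> a; apply/measurable_EFinP/measurable_funM; first exact: measurable_prod_sums.
  exact: (@measurable_prod_RV _ _ _ _ _ _ _ (fun _ t => t)).
- move=> a w _; rewrite lee_fin mulr_ge0// ?prodr_ge0//.
  by move=> B _; rewrite sumr_ge0.
rewrite (eq_big_seq (fun=> ((\prod_(B <- As) (size B)%:R) * mu ^+ (size As + size s).+1)%:E)).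
  rewrite sumEFin big_const_seq count_predT iter_addr_0 big_cons addSn.
  by rewrite -(mulr_natl (_ * _)) mulrA.
move=> a aA; rewrite IH//= ?addnS//.
  by rewrite us andbT; apply: contraNN sA => as_; apply/hasP; exists a.
apply/allP => B BAs; have := AAs B BAs; have := sAs B BAs.
move=> /hasPn sB /hasPn AB; apply/hasPn => b bB /=; rewrite inE negb_or.
by rewrite (sB b bB) andbT; apply: contraNN (AB b bB) => /eqP -> /=.
Qed.

(** The Markov inequality for all blocks at once, in the form of an expectation:
    if every block sum is at least [c], the product is at least [1]. *)
Lemma expectation_prod_ratios (m N : nat) (A : nat -> seq I) (c e : R) :
  (forall t t', t != t' -> apart (A t) (A t')) ->
  (forall t, (t < m)%N -> (size (A t) <= N)%N) -> 0 < c -> N%:R * mu <= e * c ->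
  (\int[P]_w (\prod_(0 <= t < m) ((\sum_(z <- A t) V z w) / c))%:E <= (e ^+ m)%:E)%E.
Proof.
move=> disj sz c0 Nc.
have e0 : 0 <= e by rewrite -(pmulr_lge0 _ c0) (le_trans _ Nc)// mulr_ge0.
pose As := [seq A t | t <- iota 0 m].
have prodE w : \prod_(0 <= t < m) ((\sum_(z <- A t) V z w) / c) =
    c^-1 ^+ m * (\prod_(B <- As) \sum_(z <- B) V z w).
  rewrite big_split/= big_const_nat subn0 iter_mulr_1 mulrC /As big_map.
  by rewrite /index_iota subn0.
have ci0 : 0 <= c^-1 ^+ m by rewrite exprn_ge0// invr_ge0 ltW.
under eq_integral do rewrite prodE EFinM.
rewrite ge0_integralZl//; last 2 first.
- by apply/measurable_EFinP; exact: measurable_prod_sums.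
- by move=> w _; rewrite lee_fin prodr_ge0// => B _; rewrite sumr_ge0.
have pA : pairwise apart As.
  rewrite pairwise_map; have := iota_uniq 0 m; rewrite uniq_pairwise.
  by apply: sub_pairwise => t t' /=; exact: disj.
have allA : all (apart [::]) As by apply/allP => B _; apply/hasPn.
have -> : (\int[P]_w (\prod_(B <- As) \sum_(z <- B) V z w)%:E =
    ((\prod_(B <- As) (size B)%:R) * mu ^+ (size As + 0))%:E)%E.
  rewrite -(expectation_prod_sums pA (s := [::]))//.
  by apply: eq_integral => w _; rewrite big_nil mulr1.
rewrite -EFinM lee_fin addn0 size_map size_iota.
rewrite /As big_map (_ : iota 0 m = index_iota 0 m); last first.
  by rewrite /index_iota subn0.
apply: (@le_trans _ _ (c^-1 ^+ m * ((N%:R ^+ m) * mu ^+ m))).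
  rewrite ler_wpM2l// ler_wpM2r ?exprn_ge0//.
  rewrite -[X in _ <= X](_ : \prod_(0 <= t < m) N%:R = _); last first.
    by rewrite big_const_nat subn0 iter_mulr_1.
  rewrite big_nat [leRHS]big_nat; apply: ler_prod => t /andP[_ tm].
  by rewrite ler0n ler_nat sz.
by rewrite -!exprMn lerXn2r ?nnegrE ?mulr_ge0 ?invr_ge0 ?(ltW c0)// mulrC ler_pdivrMr.
Qed.

End disjoint_sums.

(** * Disjoint families of spheres and of routes *)

Section disjoint_families.
Context {d : nat}.
Local Notation T := 'rV[int]_d.
Implicit Types (x y z a b : T).

Lemma sphere_seq_apart r r' y : r != r' -> apart (sphere_seq r y) (sphere_seq r' y).
Proof.
have H s t a : (s < t)%N -> in_sphere s y a -> ~~ in_sphere t y a.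
  move=> st /andP[/forallP sa _]; rewrite negb_and negbK; apply/orP; right.
  by apply/forallP => j; exact: leq_ltn_trans (sa j) st.
move=> rr'; apply/hasPn => a; rewrite mem_sphere_seq => r'a /=.
rewrite mem_sphere_seq; apply/negP => ra.
case: (ltngtP r r') rr' => // lt _.
  by move: r'a; apply/negP; exact: H lt ra.
by move: ra; apply/negP; exact: H lt r'a.
Qed.

Definition crd_sign y (j : 'I_d) : int := if 0 <= crd y j then 1 else -1.

(** Displacements along which a path that is monotone from [0] to [y] never meets
    its own translates: coordinates [0] and [1] vary in opposite senses relative
    to the path. *)
Definition shift y (t : nat) : T :=
  \row_j (if val j == 0%N then crd_sign y j * t%:Z
          else if val j == 1%N then - (crd_sign y j * t%:Z) else 0).

Lemma shift_box y t k : (t <= k)%N -> in_box k 0 (shift y t).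
Proof.
move=> tk; apply/forallP => j; rewrite crd_row (_ : crd (0 : T) j = 0); last first.
  by rewrite /crd mxE.
by rewrite /crd_sign; do ?case: ifP => _; lia.
Qed.

Lemma shift_route_apart y (p : seq T) t t' : (2 <= d)%N ->
  (forall a, a \in 0 :: p -> between 0 y a) ->
  (forall a b, a \in 0 :: p -> b \in 0 :: p ->
     (forall j, 0 <= (crd b j - crd a j) * (crd y j - crd 0 j)) \/
     (forall j, (crd b j - crd a j) * (crd y j - crd 0 j) <= 0)) ->
  t != t' -> apart [seq shift y t + a | a <- 0 :: p] [seq shift y t' + a | a <- 0 :: p].
Proof.
move=> d2 bet mono tt'; apply/hasPn => _ /mapP[b bp ->].
apply/negP => inA; have /mapP[a ap ab] :
  shift y t' + b \in [seq shift y t + a | a <- 0 :: p] := inA.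
have crd0 j : crd (0 : T) j = 0 by rewrite /crd mxE.
pose i0 := Ordinal (leq_trans (isT : (0 < 2)%N) d2); pose i1 := Ordinal d2.
have e0 : crd_sign y i0 * t'%:Z + crd b i0 = crd_sign y i0 * t%:Z + crd a i0.
  by have := congr1 (crd^~ i0) ab; rewrite !crdD !crd_row.
have e1 : - (crd_sign y i1 * t'%:Z) + crd b i1 = - (crd_sign y i1 * t%:Z) + crd a i1.
  by have := congr1 (crd^~ i1) ab; rewrite !crdD !crd_row.
have a0 := bet a ap i0; have b0 := bet b bp i0.
have a1 := bet a ap i1; have b1 := bet b bp i1.
have m : (0 <= (crd b i0 - crd a i0) * crd y i0 /\
          0 <= (crd b i1 - crd a i1) * crd y i1) \/
         ((crd b i0 - crd a i0) * crd y i0 <= 0 /\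
          (crd b i1 - crd a i1) * crd y i1 <= 0).
  by have [H|H] := mono a b ap bp; [left|right]; have := H i0; have := H i1;
    rewrite !crd0 !subr0.
move: e0 e1 a0 b0 a1 b1 m; rewrite !crd0 /crd_sign.
move: (crd b i0) (crd a i0) (crd b i1) (crd a i1) (crd y i0) (crd y i1) => B0 A0 B1 A1 Y0 Y1.
have tt : t%:Z != t'%:Z by [].
move: t%:Z t'%:Z tt => u u' uu.
case: (lerP 0 Y0) => Y0s; case: (lerP 0 Y1) => Y1s e0 e1 a0 b0 a1 b1.
- have [Y00|Y00] := eqVneq Y0 0; first by lia.
  have [Y10|Y10] := eqVneq Y1 0; first by lia.
  have Y0p : 0 < Y0 by lia. have Y1p : 0 < Y1 by lia.
  by rewrite !pmulr_lge0// !pmulr_lle0//; lia.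
- have [Y00|Y00] := eqVneq Y0 0; first by lia.
  have Y0p : 0 < Y0 by lia.
  by rewrite (pmulr_lge0 _ Y0p) (pmulr_lle0 _ Y0p) (nmulr_lge0 _ Y1s) (nmulr_lle0 _ Y1s); lia.
- have [Y10|Y10] := eqVneq Y1 0; first by lia.
  have Y1p : 0 < Y1 by lia.
  by rewrite (pmulr_lge0 _ Y1p) (pmulr_lle0 _ Y1p) (nmulr_lge0 _ Y0s) (nmulr_lle0 _ Y0s); lia.
- by rewrite !nmulr_lge0// !nmulr_lle0//; lia.
Qed.

Lemma path_translate x (p : seq T) z :
  path adjacent (x + z) [seq x + a | a <- p] = path adjacent z p.
Proof.
elim: p z => //= a p IH z; rewrite IH; congr (_ && _).
by rewrite /adjacent opprD addrACA subrr add0r.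
Qed.

End disjoint_families.

(** * Good scales *)

Section good_scales.
Context {R : realType} {d : nat}.
Local Notation T := 'rV[int]_d.

(** With [2 ^ k] of the order of the norm of [y], a connection of cost
    [K * 2 ^ k] loses only an exponential factor in that norm.  Radii from [k + 1]
    to [2 k + 1] leave a choice between [k + 1] disjoint spheres, all of them
    around the end point [x + y] of a route translated by at most [k]. *)
Definition good_scale (K : R) (v : T -> R) (k : nat) : Prop :=
  \sum_(z <- box_seq k 0) v z <= K * 2 ^+ k /\
  forall y : T, (l1norm y < 2 ^ k.+1)%N ->
  (exists x (q : seq T), [/\ in_box k 0 x, path adjacent x q, last x q = x + y,
     size q = l1norm y & \sum_(z <- x :: q) v z <= K * 2 ^+ k]) /\
  (exists r, [/\ (k < r)%N, (r <= (2 * k).+1)%N &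
     \sum_(z <- sphere_seq r y) v z <= K * 2 ^+ k]).

Lemma prod_lt1_exists (m : nat) (f : nat -> R) :
  \prod_(0 <= t < m) f t < 1 -> exists2 t, (t < m)%N & f t < 1.
Proof.
move=> f1; apply: contrapT => nex; move: f1; rewrite ltNge => /negP; apply.
rewrite big_nat; elim/big_ind: _ => // [a b|t /andP[_ tm]]; first exact: mulr_ege1.
by rewrite leNgt; apply/negP => ft; apply: nex; exists t.
Qed.

Lemma geometric_nneseries (B a : R) (f : nat -> \bar R) : 0 <= B -> 0 <= a -> a < 1 ->
  (forall k, 0 <= f k)%E -> (forall k, f k <= (B * a ^+ k)%:E)%E ->
  (\sum_(k <oo) f k < +oo)%E.
Proof.
move=> B0 a0 a1 f0 fB; apply: (@le_lt_trans _ _ (B / (1 - a))%:E); last exact: ltry.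
apply: lime_le; first exact: is_cvg_nneseries.
apply: nearW => n; apply: (@le_trans _ _ (\sum_(0 <= k < n) (B * a ^+ k)%:E)%E).
  exact: lee_sum.
rewrite sumEFin lee_fin -mulr_sumr ler_wpM2l//.
have a1' : 0 < 1 - a by rewrite subr_gt0.
rewrite -(ler_pM2l a1') mulfV ?gt_eqF// big_mkord.
have := subrX1 a n; have : 0 <= a ^+ n by rewrite exprn_ge0.
by nra.
Qed.

(** The series of the [Z k] has finite expectation, hence converges almost surely
    and its terms tend to [0].  This replaces the Borel-Cantelli argument for the
    events [1 <= Z k]. *)
Lemma ae_eventually_lt1 dO (Omega : measurableType dO) (P : probability Omega R)
    (Z : nat -> Omega -> R) (B a : R) :
  (forall k, measurable_fun setT (Z k)) -> (forall k w, 0 <= Z k w) ->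
  0 <= B -> 0 <= a -> a < 1 ->
  (forall k, (\int[P]_w (Z k w)%:E <= (B * a ^+ k)%:E)%E) ->
  {ae P, forall w, exists k0, forall k, (k0 <= k)%N -> Z k w < 1}.
Proof.
move=> mZ Z0 B0 a0 a1 ZB.
have mZE k : measurable_fun setT (fun w => (Z k w)%:E) by exact/measurable_EFinP.
have ZE0 k w : (0 <= (Z k w)%:E)%E by rewrite lee_fin.
pose S w := (\sum_(k <oo) (Z k w)%:E)%E.
have S0 w : (0 <= S w)%E by exact: nneseries_ge0.
have mS : measurable_fun setT S.
  have := @ge0_emeasurable_sum _ Omega R setT (fun k w => (Z k w)%:E) xpredT
    (fun k w _ _ => ZE0 k w) (fun k _ => mZE k).
  by apply: eq_measurable_fun => w _.
have IS : (\int[P]_w S w < +oo)%E.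
  rewrite integral_nneseries//; apply: (geometric_nneseries B0 a0 a1) => // k.
  exact: integral_ge0.
have iS : P.-integrable setT S.
  apply/integrableP; split=> //.
  by under eq_integral do rewrite gee0_abs//.
have := integrable_ae measurableT iS; apply: filterS => w /(_ I) Sfin.
have Soo : (S w < +oo)%E by rewrite -ge0_fin_numE.
have := nneseries_tail_cvg Soo (fun k _ => ZE0 k w).
move=> /fine_cvgP[fin_tail /cvgrPdist_lt/(_ 1 ltr01)].
move: fin_tail => [N1 _ N1P] [N2 _ N2P].
exists (maxn N1 N2) => k; rewrite geq_max => /andP[kN1 kN2].
have f1 := N1P k kN1; have := N2P k kN2; rewrite /= sub0r normrN => tail1.
rewrite -lte_fin; apply: (@le_lt_trans _ _ (\sum_(k <= j <oo) (Z j w)%:E)%E).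
  rewrite (nneseries_split k 1)// addn1 big_nat1 leeDl//.
  by apply: nneseries_ge0.
rewrite -(fineK f1) lte_fin; exact: le_lt_trans (ler_norm _) tail1.
Qed.

End good_scales.

Section environment.
Context {R : realType} {d : nat} {F : cumulativeBounded (0 : R) (1 : R)}
  {dO : measure_display} {Omega : measurableType dO} {P : probability Omega R}
  {V : 'rV[int]_d -> {RV P >-> R}}.
Hypothesis iidV : iid_potential F V.
Hypothesis d2 : (2 <= d)%N.
Variable mu : R.
Hypothesis mu0 : 0 <= mu.
Hypothesis Vmu : forall z, (\int[P]_w (V z w)%:E = mu%:E)%E.
Variable C : R.
Hypothesis C0 : 0 < C.
Hypothesis HC : forall k, (4 * k + 3)%N%:R ^+ d <= C * (3 / 2) ^+ k.
Local Notation T := 'rV[int]_d.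
Local Notation eps := ((2 : R)^-1 ^+ d.+1).
(* A block of [N] sites costs [N * mu] on average; [K] makes this at most
   [eps * (K * 2 ^ k)] for all blocks that occur at scale [k]. *)
Local Notation K := (2 ^+ d.+1 * ((mu + 1) * (C + 2))).

Let V0 z w : 0 <= V z w. Proof. exact: potential_ge0 iidV z w. Qed.

Let K_gt0 : 0 < K.
Proof.
have m := mu0; have c := C0.
by apply: mulr_gt0; [exact: exprn_gt0|apply: mulr_gt0; lra].
Qed.

Let cost_gt0 k : 0 < K * 2 ^+ k.
Proof. by rewrite mulr_gt0// exprn_gt0. Qed.

Let epsK k : eps * (K * 2 ^+ k) = (mu + 1) * (C + 2) * 2 ^+ k.
Proof. by rewrite !mulrA exprVn mulVf ?mul1r// expf_neq0. Qed.

Let cost_block (N k : nat) : N%:R <= (C + 2) * 2 ^+ k :> R -> N%:R * mu <= eps * (K * 2 ^+ k).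
Proof.
move=> Nk; rewrite epsK; have p0 : 0 <= 2 ^+ k :> R by rewrite exprn_ge0.
apply: (@le_trans _ _ ((C + 2) * 2 ^+ k * mu)); first by rewrite ler_wpM2r.
rewrite -(mulrA (mu + 1)) [leRHS]mulrC ler_wpM2l//; last by rewrite lerDl.
by rewrite mulr_ge0// addr_ge0// ltW.
Qed.

Let sphere_count k : (4 * k + 3)%N%:R ^+ d <= C * 2 ^+ k.
Proof.
apply: le_trans (HC k) _; rewrite ler_wpM2l ?(ltW C0)//.
by apply: lerXn2r; rewrite ?nnegrE; lra.
Qed.

(** Failure at one [y]: all the [k + 1] disjoint routes, or all the [k + 1]
    spheres, are expensive.  Each has probability at most [eps], so this has
    probability of order [2 ^ (- (d + 1) k)], against about [2 ^ (d k)] sites [y]. *)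
Lemma ae_good_scale : {ae P, forall w, exists k0, forall k, (k0 <= k)%N ->
  good_scale K (V ^~ w) k}.
Proof.
(* [Z k] dominates the indicator of failure at scale [k]: it is at least [1] if
   the central cube is expensive, or all routes or all spheres for some [y] are. *)
have [route routeP] := choice (fun y : T => route_exists 0 y).
pose A y t : seq T := [seq shift y t + a | a <- 0 :: route y].
pose cost (s : seq T) w := \sum_(z <- s) V z w.
have cost0 s w : 0 <= cost s w by rewrite sumr_ge0.
have mcost s : measurable_fun setT (cost s) by exact: measurable_sum.
pose near_y k : seq T := [seq y <- box_seq (2 ^ k.+1) 0 | (l1norm y < 2 ^ k.+1)%N].
pose Zr k y w := \prod_(0 <= t < k.+1) (cost (A y t) w / (K * 2 ^+ k)).
pose Zs k y w := \prod_(0 <= t < k.+1) (cost (sphere_seq (k.+1 + t) y) w / (K * 2 ^+ k)).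
pose Z k w := cost (box_seq k 0) w / (K * 2 ^+ k) + \sum_(y <- near_y k) (Zr k y w + Zs k y w).
have Zr0 k y w : 0 <= Zr k y w by rewrite prodr_ge0// => t _; rewrite divr_ge0// ltW.
have Zs0 k y w : 0 <= Zs k y w by rewrite prodr_ge0// => t _; rewrite divr_ge0// ltW.
have mprod k (f : nat -> seq T) : measurable_fun setT
    (fun w => \prod_(0 <= t < k.+1) (cost (f t) w / (K * 2 ^+ k))).
  by apply: measurable_prod => t _; apply: measurable_funM.
have mZrs k y : measurable_fun setT (fun w => Zr k y w + Zs k y w).
  by apply: measurable_funD; exact: mprod.
have mZ k : measurable_fun setT (Z k).
  by apply: measurable_funD; [exact: measurable_funM|exact: measurable_sum].
have Z0 k w : 0 <= Z k w.
  by rewrite addr_ge0 ?divr_ge0 ?(ltW (cost_gt0 _))// sumr_ge0// => y _; rewrite addr_ge0.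
have sizeA y t : size (A y t) = (l1norm y).+1.
  by have [_ _ _ + _] := routeP y; rewrite size_map /= subr0 => ->.
have EZr k y : (l1norm y < 2 ^ k.+1)%N -> (\int[P]_w (Zr k y w)%:E <= (eps ^+ k.+1)%:E)%E.
  move=> yk; apply: (@expectation_prod_ratios _ _ _ _ _ _ (potential_indep iidV)
    mu mu0 V0 Vmu k.+1 (2 ^ k.+1)%N (A y) (K * 2 ^+ k)) => //.
  - move=> t t' tt'; have [_ _ _ _ [bet mono]] := routeP y.
    exact: shift_route_apart.
  - by move=> t _; rewrite sizeA.
  - apply: cost_block; rewrite natrX exprS ler_wpM2r ?exprn_ge0// lerDr.
    exact: ltW.
have EZs k y : (\int[P]_w (Zs k y w)%:E <= (eps ^+ k.+1)%:E)%E.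
  apply: (@expectation_prod_ratios _ _ _ _ _ _ (potential_indep iidV)
    mu mu0 V0 Vmu k.+1 ((4 * k + 3) ^ d)%N (fun t => sphere_seq (k.+1 + t) y)
    (K * 2 ^+ k)) => //.
  - by move=> t t' tt'; apply: sphere_seq_apart; rewrite eqn_add2l.
  - move=> t tk; apply: leq_trans (size_sphere_seq _ _) _; rewrite leq_exp2r//; last lia.
    lia.
  - apply: cost_block; rewrite natrX (le_trans (sphere_count k))// ler_wpM2r ?exprn_ge0//.
    by rewrite lerDl.
have Ecost s : (\int[P]_w (cost s w)%:E = ((size s)%:R * mu)%:E)%E.
  under eq_integral do rewrite -sumEFin.
  rewrite ge0_integral_sum//; [|by move=> z; exact/measurable_EFinP|by move=> z w _; rewrite lee_fin V0].
  under eq_bigr do rewrite Vmu.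
  by rewrite sumEFin big_const_seq count_predT iter_addr_0 mulr_natl.
have EZ k : (\int[P]_w (Z k w)%:E <= ((1 + 4 ^+ d) * (3 / 4) ^+ k)%:E)%E.
  rewrite /Z; under eq_integral do rewrite EFinD.
  have mbox : measurable_fun setT (fun w => cost (box_seq k 0) w / (K * 2 ^+ k)).
    exact: measurable_funM.
  rewrite ge0_integralD; [|by []|by move=> w _; rewrite lee_fin divr_ge0// ltW|
    exact/measurable_EFinP|
    by move=> w _; rewrite lee_fin sumr_ge0// => y _; rewrite addr_ge0|
    by apply/measurable_EFinP; exact: measurable_sum].
  rewrite (mulrDl 1 (4 ^+ d)) mul1r EFinD; apply: leeD.
    under eq_integral do rewrite mulrC EFinM.
    rewrite ge0_integralZl; [|by []|exact/measurable_EFinP|by move=> w _; rewrite lee_fin|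
      by rewrite lee_fin invr_ge0 ltW].
    rewrite Ecost size_box_seq -EFinM lee_fin mulrC ler_pdivrMr// natrX.
    apply: (@le_trans _ _ (C * (3 / 2) ^+ k * mu)).
      rewrite ler_wpM2r// (le_trans _ (HC k))// lerXn2r ?nnegrE ?ler0n// ler_nat.
      by lia.
    rewrite (_ : (3 / 4) ^+ k * _ = K * (3 / 2) ^+ k); last first.
      by rewrite mulrCA -exprMn; congr (_ * _ ^+ _); field.
    rewrite mulrAC ler_wpM2r ?exprn_ge0//.
    have K1 : (mu + 1) * (C + 2) <= K.
      by apply: ler_peMl; [rewrite mulr_ge0 ?addr_ge0 ?(ltW C0)|apply: exprn_ege1; lra].
    by apply: le_trans K1; have := mu0; have := C0; nra.
  under eq_integral do rewrite -sumEFin.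
  rewrite ge0_integral_sum; [|by []|by move=> y; exact/measurable_EFinP|
    by move=> y w _; rewrite lee_fin addr_ge0].
  apply: (@le_trans _ _ (\sum_(y <- near_y k) (2 * eps ^+ k.+1)%:E)%E).
    rewrite big_seq [leRHS]big_seq; apply: lee_sum => y.
    rewrite mem_filter => /andP[yk _].
    under eq_integral do rewrite EFinD.
    rewrite ge0_integralD; [|by []|by move=> w _; rewrite lee_fin|by apply/measurable_EFinP; exact: mprod|
      by move=> w _; rewrite lee_fin|by apply/measurable_EFinP; exact: mprod].
    by rewrite mulr2n mulrDl mul1r EFinD; apply: leeD; [exact: EZr|exact: EZs].
  rewrite sumEFin lee_fin big_const_seq count_predT iter_addr_0 -(mulr_natl (_ * _)).
  have szn : (size (near_y k))%:R <= (8 * 2 ^+ k) ^+ d :> R.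
    apply: (@le_trans _ _ ((2 * 2 ^ k.+1).+1 ^ d)%N%:R).
      by rewrite ler_nat -(size_box_seq _ (0 : T)) size_filter count_size.
    rewrite natrX lerXn2r ?nnegrE ?ler0n ?mulr_ge0 ?exprn_ge0//.
    rewrite -natr1 natrM natrX exprS.
    have : 1 <= 2 ^+ k :> R by apply: exprn_ege1; lra.
    by lra.
  apply: (@le_trans _ _ ((8 * 2 ^+ k) ^+ d * (2 * eps ^+ k.+1))).
    have e0 : 0 <= eps by rewrite exprn_ge0// invr_ge0.
    by apply: ler_wpM2r => //; apply: mulr_ge0 => //; exact: exprn_ge0.
  rewrite (_ : _ * _ = 4 ^+ d * (1 / 2) ^+ k); last first.
    have -> : eps ^+ k.+1 = (2 ^+ (k * d) * 2 ^+ d * 2 ^+ k * 2)^-1.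
      by rewrite -exprM exprVn -!exprD -exprSr; congr (_ ^+ _)^-1; lia.
    have -> : (8 * 2 ^+ k) ^+ d = (2 ^+ d) ^+ 3 * 2 ^+ (k * d) :> R.
      rewrite exprMn -exprM (_ : 8 = 2 ^+ 3 :> R); last by ring.
      by rewrite -!exprM mulnC.
    have -> : 4 ^+ d = (2 ^+ d) ^+ 2 :> R.
      rewrite (_ : 4 = 2 ^+ 2 :> R); last by ring.
      by rewrite -!exprM mulnC.
    have -> : (1 / 2) ^+ k = (2 ^+ k)^-1 :> R by rewrite mul1r exprVn.
    have p k' : 2 ^+ k' != 0 :> R by rewrite expf_neq0.
    by field; rewrite !p.
  rewrite ler_wpM2l ?exprn_ge0// lerXn2r ?nnegrE; lra.
have B1 : 0 <= 1 + 4 ^+ d :> R by rewrite addr_ge0// exprn_ge0.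
have a0 : 0 <= 3 / 4 :> R by lra.
have a1 : 3 / 4 < 1 :> R by lra.
have := ae_eventually_lt1 mZ Z0 B1 a0 a1 EZ.
apply: filterS => w [k0 Hk]; exists k0 => k /Hk Zlt1.
have ltD1 (a b : R) : 0 <= b -> a + b < 1 -> a < 1 by lra.
have c0 := cost_gt0 k.
have S0 : 0 <= \sum_(y <- near_y k) (Zr k y w + Zs k y w).
  by rewrite sumr_ge0// => y _; rewrite addr_ge0.
have B0 : 0 <= cost (box_seq k 0) w / (K * 2 ^+ k) by rewrite divr_ge0// ltW.
split.
  by rewrite -[leRHS]mul1r -ler_pdivrMr//; apply: ltW; exact: ltD1 S0 Zlt1.
move=> y yk.
have Zy : Zr k y w + Zs k y w < 1.
  have yn : y \in near_y k.
    rewrite mem_filter yk mem_box_seq; apply/forallP => j.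
    have -> : crd (0 : T) j = 0 by rewrite /crd mxE.
    rewrite subr0; apply: leq_trans (ltnW yk).
    by rewrite l1normE (bigD1 j)//= leq_addr.
  move: Zlt1; rewrite /Z addrC => /(ltD1 _ _ B0); rewrite (big_rem y yn)/=.
  by apply: ltD1; rewrite sumr_ge0// => z _; rewrite addr_ge0.
have pr : Zr k y w < 1 by exact: ltD1 (Zs0 k y w) Zy.
have sr : Zs k y w < 1 by move: Zy; rewrite addrC; exact: ltD1.
split.
  have [t tk] := prod_lt1_exists pr; rewrite ltr_pdivrMr// mul1r => ct.
  have [adp lp _ sp _] := routeP y.
  exists (shift y t), [seq shift y t + a | a <- route y]; split.
  - exact: shift_box.
  - by rewrite -{1}(addr0 (shift y t)) path_translate.
  - by rewrite -{1}(addr0 (shift y t)) (last_map (fun a => shift y t + a)) lp addrC.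
  - by rewrite size_map sp subr0.
  - by move: ct; rewrite /cost /A /= addr0 => /ltW.
have [t tk] := prod_lt1_exists sr; rewrite ltr_pdivrMr// mul1r => ct.
exists (k.+1 + t)%N; split; [by rewrite addSn ltnS leq_addr| |exact: ltW].
by rewrite addSn ltnS mul2n -addnn leq_add2l -ltnS.
Qed.

End environment.

(** * Long paths leaving the origin *)

Section outward_mass.
Context {R : realType} {d : nat} {F : cumulativeBounded (0 : R) (1 : R)}
  {dO : measure_display} {Omega : measurableType dO} {P : probability Omega R}
  {V : 'rV[int]_d -> {RV P >-> R}}.
Hypothesis iidV : iid_potential F V.
Hypothesis d3 : (3 <= d)%N.
Local Notation T := 'rV[int]_d.
Local Notation phi := (laplace1 F).

(** Each visited site costs a factor [phi], that is [expR (- l)] for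
    [l = - ln phi], on average.  Refunding half of this cost still leaves an
    expectation dominated by the law of the walk, and the damping [defect] at the
    end point makes the sum over all end points finite. *)
Definition outward_mass (l : R) (v : T -> R) : \bar R :=
  \esum_(a in [set: seq T])
    (path_weight v 0 a * (expR (l / 2 * (range_size 0 a)%:R) * defect (last (0 : T) a)))%:E.

Let term0 l v a : (0 <= (path_weight v 0 a *
  (expR (l / 2 * (range_size 0 a)%:R) * defect (last (0 : T) a)))%:E :> \bar R)%E.
Proof.
by rewrite lee_fin mulr_ge0 ?path_weight_ge0// mulr_ge0 ?expR_ge0// ltW ?defect_gt0.
Qed.

Lemma ae_outward_mass_fin : F 0 < 1 ->
  {ae P, forall w, (outward_mass (- ln phi) (V ^~ w) < +oo)%E}.
Proof.
move=> F0; have phi0 := laplace1_gt0 iidV; have phi1 := laplace1_lt1 iidV F0.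
pose X w := outward_mass (- ln phi) (V ^~ w).
have X0 w : (0 <= X w)%E by apply: esum_ge0 => a _; exact: term0.
have mt a : measurable_fun setT (fun w => (path_weight (V ^~ w) 0 a *
    (expR (- ln phi / 2 * (range_size 0 a)%:R) * defect (last (0 : T) a)))%:E).
  by apply/measurable_EFinP/measurable_funM => //; exact: measurable_path_weight.
have mX : measurable_fun setT X by exact: measurable_fun_esum.
have IX : (\int[P]_w X w <= 1)%E.
  rewrite integral_esum//; apply: le_trans (esum_defect 0 0 d3).
  apply: le_esum => a _; rewrite subr0.
  under eq_integral do rewrite mulrC EFinM.
  have wa0 : 0 <= expR (- ln phi / 2 * (range_size 0 a)%:R) * defect (last (0 : T) a).
    by rewrite mulr_ge0 ?expR_ge0// ltW ?defect_gt0.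
  rewrite ge0_integralZl; [|by []|by apply/measurable_EFinP; exact: measurable_path_weight|
    by move=> w _; rewrite lee_fin path_weight_ge0|by rewrite lee_fin].
  apply: le_trans (lee_wpmul2l _ (expectation_weight_le iidV 0 a)) _; first by rewrite lee_fin.
  rewrite -EFinM lee_fin mulrCA ler_wpM2l ?step_prob_ge0//.
  rewrite mulrAC ler_piMl ?(ltW (defect_gt0 _))//.
  have -> : phi ^+ range_size 0 a = expR (ln phi * (range_size 0 a)%:R).
    by rewrite expRM_natr lnK.
  rewrite -expRD -[leRHS]expR0 ler_expR.
  have lphi : ln phi < 0 by rewrite ln_lt0// phi0.
  have := mulr_ge0 (ler0n R (range_size 0 a)) (_ : 0 <= - ln phi).
  by move=> /(_ ltac:(rewrite oppr_ge0; exact: ltW)); lra.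
have iX : P.-integrable setT X.
  apply/integrableP; split=> //; under eq_integral do rewrite gee0_abs//.
  exact: le_lt_trans IX (ltry _).
have := integrable_ae measurableT iX; apply: filterS => w /(_ I).
by rewrite ge0_fin_numE.
Qed.

(** For range size [r] at least [K], the factor [r] is absorbed by
    [r <= 4 / l * expR (l / 4 * r)], and
    [expR (l / 4 * r) <= expR (- (l / 4 * K)) * expR (l / 2 * r)] leaves a gain
    exponential in [K] in front of the mass. *)
Lemma far_sum_le (l M K X : R) (v : T -> R) (D : set (seq T)) :
  0 < l -> 0 <= M -> (outward_mass l v = X%:E)%E ->
  (forall a, D a -> K < (range_size 0 a)%:R /\ (defect (last (0 : T) a))^-1 <= M) ->
  (\esum_(a in D) ((range_size 0 a)%:R * path_weight v 0 a)%:E <=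
   (4 / l * expR (- (l / 4 * K)) * M * X)%:E)%E.
Proof.
move=> l0 M0 XE HD; pose c := 4 / l * expR (- (l / 4 * K)) * M.
have c0 : 0 <= c.
  by rewrite !mulr_ge0 ?expR_ge0// invr_ge0 ltW.
rewrite EFinM -XE /outward_mass -(esumZl _ c0 (term0 l v)).
apply: (@le_trans _ _ (\esum_(a in D) (c%:E * (path_weight v 0 a *
  (expR (l / 2 * (range_size 0 a)%:R) * defect (last (0 : T) a)))%:E))%E); last first.
  exact: esum_subset.
apply: le_esum => a /HD[Ka Ma]; rewrite -EFinM lee_fin [leLHS]mulrC [leRHS]mulrCA.
apply: ler_wpM2l; first exact: path_weight_ge0.
set r : R := (range_size 0 a)%:R; have r0 : 0 <= r by [].
have rl : r <= 4 / l * expR (l / 4 * r).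
  apply: (@le_trans _ _ (4 / l * (1 + l / 4 * r))); last first.
    by rewrite ler_wpM2l ?expR_ge1Dx// divr_ge0// ltW.
  have -> : 4 / l * (1 + l / 4 * r) = 4 / l + r by field; rewrite gt_eqF.
  by rewrite lerDr divr_ge0// ltW.
have df := defect_gt0 (last 0 a : T) : 0 < (defect (last (0 : T) a) : R).
have M1 : 1 <= M * defect (last (0 : T) a) by rewrite -(mulVf (lt0r_neq0 df)) ler_wpM2r// ltW.
have eK : expR (l / 4 * r) <= expR (- (l / 4 * K)) * expR (l / 2 * r).
  rewrite -expRD ler_expR.
  have := mulr_ge0 (ltW l0) (_ : 0 <= r - K).
  move=> /(_ ltac:(rewrite subr_ge0; exact: ltW)); lra.
rewrite /c [leRHS](_ : _ = (4 / l * (expR (- (l / 4 * K)) * expR (l / 2 * r))) *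
  (M * defect (last (0 : T) a))); last by ring.
apply: le_trans rl _; apply: (@le_trans _ _ (4 / l * (expR (- (l / 4 * K)) * expR (l / 2 * r)))).
  by rewrite ler_wpM2l// divr_ge0// ltW.
by rewrite ler_peMr// mulr_ge0 ?mulr_ge0 ?expR_ge0// invr_ge0 ltW.
Qed.

End outward_mass.

(** * The quenched bound *)

Section quenched.
Context {R : realType} {d : nat}.
Local Notation T := 'rV[int]_d.

Lemma sum_sqr_le (f : 'I_d -> nat) : (\sum_(j < d) f j ^ 2 <= (\sum_(j < d) f j) ^ 2)%N.
Proof.
rewrite [leqRHS]expnS expn1 big_distrl/=; apply: leq_sum => j _.
by rewrite expnS expn1 leq_mul2l (bigD1 j)//= leq_addr orbT.
Qed.

Lemma intr_sqr_absz (x : int) : x%:~R ^+ 2 = (absz x)%:R ^+ 2 :> R.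
Proof. by rewrite -(real_normK (num_real _)) -intr_norm -abszE. Qed.

(** The inverse of [defect] is polynomial in the norm; the exponential bound is
    enough, since it is set against weights that can be made smaller still. *)
Lemma defect_inv_le (u : T) (n : nat) : (l1norm u <= 2 * n)%N ->
  (defect u)^-1 <= 48 * (1000 * expR (2 * n%:R)) ^+ 2 :> R.
Proof.
move=> un; rewrite /defect invrK; apply: ler_wpM2l; first by rewrite ler0n.
have e0 : 0 <= expR (2 * n%:R) :> R by exact: expR_ge0.
apply: lerXn2r; rewrite ?nnegrE; [exact: radius2_ge0|lra|].
have s : \sum_(i < d) (u ord0 i)%:~R ^+ 2 <= (2 * n%:R) ^+ 2 :> R.
  rewrite (eq_bigr (fun i => ((absz (crd u i)) ^ 2)%N%:R)); last first.
    by move=> i _; rewrite intr_sqr_absz natrX.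
  rewrite -natr_sum -natrM -natrX ler_nat.
  by apply: leq_trans (sum_sqr_le _) _; rewrite leq_exp2r.
have e1 : 1 + n%:R <= expR n%:R :> R by exact: expR_ge1Dx.
have -> : expR (2 * n%:R) = expR n%:R * expR n%:R :> R by rewrite -expRD; congr expR; ring.
have n0 : 0 <= n%:R :> R by [].
rewrite /radius2; apply: (@le_trans _ _ (1000 * ((1 + n%:R) * (1 + n%:R)))).
  by nra.
apply: ler_wpM2l; first by rewrite ler0n.
by apply: ler_pM; lra.
Qed.

Lemma trunc_log_eventually (k0 n : nat) : (2 ^ k0 <= n)%N ->
  let k := trunc_log 2 n in [/\ (k0 <= k)%N, (2 ^ k <= n)%N & (n < 2 ^ k.+1)%N].
Proof.
move=> kn /=; have n0 : (0 < n)%N by apply: leq_trans kn; rewrite expn_gt0.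
have /andP[lo hi] := trunc_log_bounds (isT : 1 < 2)%N n0.
by split=> //; exact: trunc_log_max.
Qed.

(** For such [k], if the norm of [y] is at least [2 ^ k], then the cube of radius
    [2 k + 1] around [y] does not contain [0]. *)
Lemma linear_lt_exp (k : nat) : (0 < d)%N -> (4 * d <= k)%N -> (d * (2 * k).+1 < 2 ^ k)%N.
Proof.
move=> d0; elim: k => [|k IH]; first by rewrite leqn0 muln_eq0/= => /eqP d00; rewrite d00 in d0.
rewrite leq_eqVlt => /predU1P[<-|].
  have H : (d.+1 <= 2 ^ d)%N by exact: ltn_expl.
  have -> : (2 ^ (4 * d) = (2 ^ d) ^ 2 * (2 ^ d) ^ 2)%N by rewrite -!expnM -expnD; congr expn; lia.
  have H2 := leq_mul H H; have H4 := leq_mul H2 H2.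
  have H1 : (4 * d <= d.+1 * d.+1)%N by case: (d) d0 => // m _; nia.
  rewrite -mulnn; apply: leq_trans H4; apply: leq_trans (leq_mul H1 H1).
  have dd : (d <= d * d)%N by rewrite leq_pmulr.
  by move: dd d0; lia.
rewrite ltnS => dk; have := IH dk; rewrite expnS.
have : (d <= d * k)%N by rewrite leq_pmulr//; lia.
by lia.
Qed.

Variables (v : T -> R) (K C l X : R).
Hypothesis d3 : (3 <= d)%N.
Hypothesis v0 : forall z, 0 <= v z.
Hypothesis K0 : 0 < K.
Hypothesis l0 : 0 < l.
Hypothesis C0 : 0 < C.
Hypothesis HC : forall k, (4 * k + 3)%N%:R ^+ d <= C * 2 ^+ k.
Hypothesis good : exists k0, forall k, (k0 <= k)%N -> good_scale K v k.
Hypothesis XE : outward_mass l v = X%:E.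

(** The exponential rate, in the norm of [y], of the weight of a connection from
    [0] to the sphere around [y]: three cheap sets, and one factor [2 d] per site
    of their union. *)
Definition connection_rate : R := 3 * K + ln (2 * d)%N%:R * (2 * C + 2).

(** Beyond [4 / l * (connection_rate + 4)] sites per unit of norm, the gain in
    range size outweighs both the cost of a connection and the inverse defect,
    which is at most of the order of [expR (4 * n)].  [C] accounts for the cube
    around [y], and [1] for the remaining contribution of long paths. *)
Definition range_rate : R := 4 / l * (connection_rate + 4) + C + 1.

Let ln2d_ge0 : 0 <= ln (2 * d)%N%:R :> R.
Proof. by rewrite ln_ge0// (ler_nat _ 1) muln_gt0 (leq_trans _ d3). Qed.

Let connection_rate_ge0 : 0 <= connection_rate.
Proof.
have c := C0; have k := K0; rewrite /connection_rate addr_ge0//; first lra.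
by rewrite mulr_ge0//; lra.
Qed.

(** The cut at the sphere is applied at the scale [k] with
    [2 ^ k <= n < 2 ^ (k + 1)], [n] being the norm of [y].  All exponentials in [n]
    cancel, so the long paths contribute at most [B * e] with [B] independent of
    [y], and [B <= n] for [n] large. *)
Lemma range_le_eventually : exists N, forall (y : T) (e : R), (N <= l1norm y)%N ->
  \esum_(p in first_hits 0 y) (path_weight v 0 p)%:E = e%:E ->
  (\esum_(p in first_hits 0 y) ((range_size 0 p)%:R * path_weight v 0 p)%:E
    <= (range_rate * (l1norm y)%:R * e)%:E)%E.
Proof.
have [k0 Hgood] := good; pose B := 4 / l * (48 * 1000 ^+ 2) * X.
exists (maxn (2 ^ (maxn k0 (4 * d))) (Num.truncn B).+1) => y e.
set n := l1norm y; rewrite geq_max => /andP[/trunc_log_eventually].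
set k := trunc_log 2 n => -[]; rewrite geq_max => /andP[kk0 k4d] kn nk Bn eE.
have [box_le /(_ y nk)[[x [q [kx adq lq sq route_le]]] [r [kr rk sphere_le]]]] := Hgood k kk0.
have d0 : (0 < d)%N by rewrite (leq_trans _ d3).
have d2 : (2 <= d)%N by rewrite (leq_trans _ d3).
have r0 : (0 < r)%N by rewrite (leq_ltn_trans _ kr).
have dr : (d * r < n)%N.
  by apply: leq_trans kn; apply: leq_ltn_trans (linear_lt_exp d0 k4d); rewrite leq_mul2l rk orbT.
have y_far : ~~ in_box r y 0.
  apply/negP => /forallP yr; move: dr; apply/negP; rewrite -leqNgt /n l1normE.
  rewrite -[X in (X * r)%N](card_ord d) -sum_nat_const; apply: leq_sum => j _.
  have := yr j; have -> : crd (0 : T) j = 0 by rewrite /crd mxE.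
  by rewrite sub0r abszN.
have kr' : in_box r y (last x q).
  rewrite lq; apply/forallP => j; have := forallP kx j; rewrite crdD.
  have -> : crd (0 : T) j = 0 by rewrite /crd mxE.
  by move: kr; clear; lia.
have knR : 2 ^+ k <= n%:R :> R by rewrite -natrX ler_nat.
have n1 : 1 <= n%:R :> R by apply: le_trans knR; apply: exprn_ege1; lra.
have box_count s : (s <= (2 * k).+1)%N -> ((2 * s).+1 ^ d)%N%:R <= C * n%:R :> R.
  move=> sk; apply: (@le_trans _ _ ((4 * k + 3)%N%:R ^+ d)).
    by rewrite natrX lerXn2r ?nnegrE ?ler0n// ler_nat; move: sk; clear; lia.
  by apply: le_trans (HC k) _; rewrite ler_wpM2l// ltW.
pose c := expR (- (connection_rate * n%:R)).
have reach u : in_sphere r y u -> exists p : seq T,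
    [/\ last 0 p = u, y \notin 0 :: p & c <= path_weight v 0 p].
  move=> su; have [p [lp yp wp]] := reach_sphere d2 v0 r0 y_far kx adq kr' box_le route_le sphere_le su.
  exists p; split=> //; apply: le_trans wp; rewrite ler_expR lerN2 /connection_rate.
  rewrite [leRHS]mulrDl; apply: lerD.
    by rewrite -!mulrA ler_wpM2l// ler_wpM2l// ltW.
  rewrite -mulrA ler_wpM2l// !natrD /= sq size_box_seq -/n -natr1.
  have h1 := box_count k (ltac:(clear; lia)).
  have h2 : (size (sphere_seq r y))%:R <= C * n%:R.
    by apply: le_trans (box_count r rk); rewrite ler_nat size_sphere_seq.
  by lra.
pose M := 48 * (1000 * expR (2 * n%:R)) ^+ 2 : R.
have M0 : 0 <= M by apply: mulr_ge0; [rewrite ler0n|exact: sqr_ge0].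
pose A := 4 / l * (connection_rate + 4).
have A0 : 0 <= A * n%:R.
  have cr := connection_rate_ge0; apply: mulr_ge0 => //; apply: mulr_ge0; last lra.
  by apply: divr_ge0 => //; exact: ltW.
pose D : set (seq T) :=
  [set a | in_sphere r y (last 0 a) /\ A * n%:R < (range_size 0 a)%:R].
have norm_le u : in_box r y u -> (l1norm u <= 2 * n)%N.
  move=> /forallP yu; apply: (@leq_trans (n + d * r)); last by rewrite mul2n -addnn leq_add2l ltnW.
  rewrite /n !l1normE -[X in (X * r)%N](card_ord d) -sum_nat_const -big_split/=.
  by apply: leq_sum => j _; have := yu j; clear; lia.
have DM a : D a -> A * n%:R < (range_size 0 a)%:R /\ (defect (last (0 : T) a))^-1 <= M.
  by move=> [/andP[sa _] Ra]; split=> //; apply: defect_inv_le; exact: norm_le.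
have e0 : 0 <= e.
  by rewrite -lee_fin -eE; apply: esum_ge0 => p _; rewrite lee_fin path_weight_ge0.
have X0 : 0 <= X.
  rewrite -lee_fin -XE; apply: esum_ge0 => a _.
  by rewrite lee_fin mulr_ge0 ?path_weight_ge0// mulr_ge0 ?expR_ge0// ltW ?defect_gt0.
have c0 : 0 < c by exact: expR_gt0.
apply: le_trans (range_crossing_le c0 r0 A0 y_far reach eE) _.
have ce0 : (0 <= (c^-1 * e)%:E)%E by rewrite lee_fin mulr_ge0// invr_ge0 ltW.
apply: le_trans (leeD2l _ (lee_wpmul2l ce0 (far_sum_le l0 M0 XE DM))) _.
rewrite -EFinM -EFinD lee_fin.
have far_le : c^-1 * e * (4 / l * expR (- (l / 4 * (A * n%:R))) * M * X) = B * e.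
  have -> : l / 4 * (A * n%:R) = (connection_rate + 4) * n%:R.
    by rewrite /A; field; rewrite gt_eqF.
  rewrite /c expRN invrK /M /B exprMn.
  have -> : expR (2 * n%:R) ^+ 2 = expR (4 * n%:R) :> R.
    by rewrite -expRM_natl; congr expR; ring.
  rewrite [LHS](_ : _ = (expR (connection_rate * n%:R) * expR (- ((connection_rate + 4) * n%:R))
    * expR (4 * n%:R)) * (4 / l * (48 * 1000 ^+ 2) * X * e)); last by ring.
  rewrite -!expRD (_ : connection_rate * n%:R + _ + _ = 0); last by ring.
  by rewrite expR0 mul1r.
rewrite far_le.
have Bn' : B <= n%:R.
  by apply: ltW; apply: lt_le_trans (truncnS_gt B) _; rewrite ler_nat.
have h := box_count r rk; rewrite size_box_seq /range_rate -/A -mulrDl.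
by apply: ler_wpM2r => //; lra.
Qed.

End quenched.

Section quenched_limsup.
Context {R : realType} {d : nat}.
Local Notation T := 'rV[int]_d.

Lemma crossing_mass_gt0 (v : T -> R) (y : T) : (0 < d)%N ->
  (0 < \esum_(p in first_hits 0 y) (path_weight v 0 p)%:E)%E.
Proof.
move=> d0; have [p [adp lp up _ _]] := route_exists 0 y.
have w0 q : (0 <= (path_weight v 0 q)%:E)%E by rewrite lee_fin path_weight_ge0.
apply: (@lt_le_trans _ _ (path_weight v 0 p)%:E).
  rewrite lte_fin mulr_gt0 ?expR_gt0// step_prob_adjacent// exprn_gt0// invr_gt0.
  by rewrite ltr0n muln_gt0.
rewrite -[leLHS](@esum_set1 _ _ p (fun q => (path_weight v 0 q)%:E))//.
apply: esum_subset => q ->; split=> //.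
by move: up; rewrite lastI rcons_uniq lp => /andP[].
Qed.

Variables (v : T -> R) (G rho : R).
Hypothesis d3 : (3 <= d)%N.
Hypothesis v0 : forall z, 0 <= v z.
Hypothesis G0 : 0 < G.
Hypothesis green : forall x z : T,
  (\esum_(p in [set p | last x p = z]) (step_prob x p)%:E <= G%:E)%E.
Hypothesis range_le : exists N, forall (y : T) (e : R), (N <= l1norm y)%N ->
  \esum_(p in first_hits 0 y) (path_weight v 0 p)%:E = e%:E ->
  (\esum_(p in first_hits 0 y) ((range_size 0 p)%:R * path_weight v 0 p)%:E
    <= (rho * (l1norm y)%:R * e)%:E)%E.

Lemma limsup_quenched_le (dW : measure_display) (W : measurableType dW)
    (PW : probability W R) (S : nat -> W -> T) : simple_random_walk PW S 0 ->
  (limsup_infty (fun y : T =>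
     quenched_expectation PW S v y (extended_hitting_time R S y) / (l1norm y)%:R%:E)
   <= (G * rho)%:E)%E.
Proof.
move=> walkS; have [N HN] := range_le.
pose far : set T := [set y | (maxn N 1 <= l1norm y)%N].
apply: (@le_trans _ _ (ereal_sup ((fun y : T =>
  (quenched_expectation PW S v y (extended_hitting_time R S y) / (l1norm y)%:R%:E)%E) @` far))).
  apply: ereal_inf_lbound; exists far => //; exists (maxn N 1) => //.
apply: ge_ereal_sup => _ [y + <-]; rewrite /far /= geq_max => /andP[Ny y1].
have d0 : (0 < d)%N by exact: leq_trans d3.
pose FH := first_hits (0 : T) y.
have w0 p : (0 <= (path_weight v 0 p)%:E)%E by rewrite lee_fin path_weight_ge0.
have crossE : crossing_weight PW S v y = (\esum_(p in FH) (path_weight v 0 p)%:E)%E.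
  rewrite /crossing_weight (@walk_expectationE _ _ _ _ _ _ _ walkS _ _ (fun=> 1))//.
  by apply: eq_esum => p _; rewrite mul1r.
have [e eE] : exists e, (\esum_(p in FH) (path_weight v 0 p)%:E = e%:E)%E.
  exists (fine (\esum_(p in FH) (path_weight v 0 p)%:E)); rewrite fineK//.
  rewrite ge0_fin_numE ?esum_ge0//; apply: le_lt_trans (ltry G).
  apply: le_trans (green 0 y); apply: (@le_trans _ _ (\esum_(p in FH) (step_prob 0 p)%:E)%E).
    by apply: le_esum => p _; rewrite lee_fin; exact: path_weight_le.
  by apply: esum_subset => p [].
have e0 : 0 < e by rewrite -lte_fin -eE; exact: crossing_mass_gt0.
have n0 : 0 < (l1norm y)%:R :> R by rewrite ltr0n.
rewrite /quenched_expectation crossE eE !inver !gt_eqF// lee_pdivrMr// lee_pdivrMr//.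
rewrite (@walk_expectationE _ _ _ _ _ _ _ walkS _ _ (fun k => k%:R))//; last first.
  by move=> w k hk; rewrite /extended_hitting_time hk.
apply: le_trans (loop_excision 0 y (ltW G0) (fun z => green z z) v0) _.
rewrite -!EFinM -!mulrA EFinM lee_wpmul2l ?lee_fin ?(ltW G0)//.
by rewrite mulrA; exact: HN.
Qed.

End quenched_limsup.

Theorem theorem4 (R : realType) (d : nat) (hd : (3 <= d)%N) :
  (forall F : cumulativeBounded (0 : R) (1 : R), class_D1 F ->
    exists2 kappa : R, 0 < kappa &
    forall (dO : measure_display) (Omega : measurableType dO)
      (P : probability Omega R) (V : 'rV[int]_d -> {RV P >-> R}),
    iid_potential F V ->
    exists Omega_bar : set Omega,
      [/\ measurable Omega_bar, P Omega_bar = 1%E &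
      forall (dW : measure_display) (W : measurableType dW)
        (PW : probability W R) (S : nat -> W -> 'rV[int]_d),
      simple_random_walk PW S 0 ->
      forall omega, Omega_bar omega ->
      (limsup_infty
        (fun y : 'rV[int]_d =>
          quenched_expectation PW S (fun x => V x omega) y (extended_hitting_time R S y)
            / (l1norm y)%:R%:E)
      < kappa%:E)%E])
  /\
  (exists D : R,
    forall F : cumulativeBounded (0 : R) (1 : R), class_D F ->
    forall (dO : measure_display) (Omega : measurableType dO)
      (P : probability Omega R) (V : 'rV[int]_d -> {RV P >-> R}),
    iid_potential F V ->
    forall (dW : measure_display) (W : measurableType dW)
      (PW : probability W R) (S : nat -> W -> 'rV[int]_d),
    simple_random_walk PW S 0 ->
    forall y : 'rV[int]_d, y != 0 ->
    (annealed_expectation PW S P (fun x => V x) y (extended_hitting_time R S y)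
       / (l1norm y)%:R%:E
    <= (D * (1 / (- ln (laplace1 F)))
          * (ln (2 * d)%N%:R - ln (laplace1 F)))%:E)%E).
Proof.
have [G G0 green] := @green_bounded R d hd.
split; last first.
  exists (G * (1 + G)) => F [_ F0] dO Omega P V iidV dW W PW S walkS y y0.
  exact: (annealed_hitting_le iidV walkS hd F0 G0 green y0).
move=> F [[_ F0] intF].
have [C C0 HC] := @poly_le_geometric R d (3 / 2) ltac:(lra).
have HC2 k : (4 * k + 3)%N%:R ^+ d <= C * 2 ^+ k.
  apply: le_trans (HC k) _; rewrite ler_wpM2l ?(ltW C0)//.
  by apply: lerXn2r; rewrite ?nnegrE; lra.
pose mu : R := fine (\int[lebesgue_stieltjes_measure F]_t `|t|%:E).
have muE : (\int[lebesgue_stieltjes_measure F]_t `|t|%:E = mu%:E)%E.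
  have /integrableP[_ intlt] := intF.
  rewrite /mu fineK// ge0_fin_numE; last by apply: integral_ge0 => t _; rewrite lee_fin.
  by under eq_integral do rewrite -abse_EFin.
have mu0 : 0 <= mu by rewrite -lee_fin -muE; apply: integral_ge0 => t _; rewrite lee_fin.
pose K : R := 2 ^+ d.+1 * ((mu + 1) * (C + 2)).
have K0 : 0 < K by rewrite mulr_gt0 ?exprn_gt0//; apply: mulr_gt0; lra.
pose rho := @range_rate R d K C (- ln (laplace1 F)).
exists (Num.max (G * rho) 0 + 1); first by rewrite ltr_wpDl// le_max lexx orbT.
move=> dO Omega P V iidV.
have V0 z w : 0 <= V z w by exact: potential_ge0 iidV z w.
have Vmu z : (\int[P]_w (V z w)%:E = mu%:E)%E.
  rewrite -muE -(expectation_potential iidV z (f := fun t => `|t|))//.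
  by apply: eq_integral => w _; rewrite ger0_norm.
  exact: normr_measurable.
have rate0 : 0 < - ln (laplace1 F).
  by rewrite oppr_gt0 ln_lt0// (laplace1_gt0 iidV) (laplace1_lt1 iidV F0).
have ae1 := ae_good_scale iidV (leq_trans (isT : (2 <= 3)%N) hd) mu0 Vmu C0 HC.
have ae2 := ae_outward_mass_fin iidV hd F0.
have ae12 : {ae P, forall w,
    (exists k0, forall k, (k0 <= k)%N -> good_scale K (V ^~ w) k) /\
    (outward_mass (- ln (laplace1 F)) (V ^~ w) < +oo)%E}.
  by apply: filterS2 ae1 ae2 => w.
have [N [mN PN badN]] := ae12.
exists (~` N); split; first exact: measurableC.
  by rewrite probability_setC// PN sube0.
move=> dW W PW S walkS w Nw.
have [good mass_fin] : (exists k0, forall k, (k0 <= k)%N -> good_scale K (V ^~ w) k) /\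
    (outward_mass (- ln (laplace1 F)) (V ^~ w) < +oo)%E.
  by apply: contrapT => nw; apply: Nw; exact: badN.
have [X XE] : exists X, outward_mass (- ln (laplace1 F)) (V ^~ w) = X%:E.
  exists (fine (outward_mass (- ln (laplace1 F)) (V ^~ w))); rewrite fineK//.
  rewrite ge0_fin_numE//; apply: esum_ge0 => a _; rewrite lee_fin.
  by rewrite mulr_ge0 ?path_weight_ge0// mulr_ge0 ?expR_ge0// ltW ?defect_gt0.
have range_le := range_le_eventually hd (V0^~ w) K0 rate0 C0 HC2 good XE.
apply: le_lt_trans (limsup_quenched_le hd (V0^~ w) G0 green range_le walkS) _.
by rewrite lte_fin (le_lt_trans (_ : _ <= Num.max (G * rho) 0))// ?le_max ?lexx// ltrDl.
Qed.
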